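(* Let $H$ be a cocommutative weak Hopf algebra in $\mathsf{C}$, let $(B,\varphi_B)$ be a left weak $H$-module algebra and let $\sigma\in Reg_{\varphi_B}(H^{\otimes 2},B)$ satisfy the twisted condition. Let $\theta_\sigma$ be the obstruction of $\sigma$. Then $\theta_\sigma\in Im(D^{2}_{\varphi_{Z(B)}})$ if and only if there exists $\alpha\in Reg_{\varphi_B}(H^{\otimes 2},B)$ that satisfies the twisted condition and the cocycle condition.
   Context: Category. $\mathsf{C}$ is a strict symmetric monoidal category with tensor product $\otimes$, unit object $K$ and symmetry $c$, in which every idempotent splits. For an object $M$ and a morphism $f$, $M\otimes f$ and $f\otimes M$ mean $id_M\otimes f$ and $f\otimes id_M$. Algebras $(A,\eta_A,\mu_A)$ are unital and associative, coalgebras $(D,\varepsilon_D,\delta_D)$ counital and coassociative; $\delta_{D\otimes E}=(D\otimes c_{D,E}\otimes E)\circ(\delta_D\otimes\delta_E)$. $D$ is cocommutative if $c_{D,D}\circ\delta_D=\delta_D$. For $f,g:D\to A$ the convolution is $f\ast g=\mu_A\circ(f\otimes g)\circ\delta_D$. Weak Hopf algebra. An object $H$ with algebra structure $(\eta_H,\mu_H)$ and coalgebra structure $(\varepsilon_H,\delta_H)$ such that: (a1) $\delta_H\circ\mu_H=(\mu_H\otimes\mu_H)\circ\delta_{H\otimes H}$; (a2) $\varepsilon_H\circ\mu_H\circ(\mu_H\otimes H)=((\varepsilon_H\circ\mu_H)\otimes(\varepsilon_H\circ\mu_H))\circ(H\otimes\delta_H\otimes H)=((\varepsilon_H\circ\mu_H)\otimes(\varepsilon_H\circ\mu_H))\circ(H\otimes(c_{H,H}\circ\delta_H)\otimes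 H)$; (a3) $(\delta_H\otimes H)\circ\delta_H\circ\eta_H=(H\otimes\mu_H\otimes H)\circ((\delta_H\circ\eta_H)\otimes(\delta_H\circ\eta_H))=(H\otimes(\mu_H\circ c_{H,H})\otimes H)\circ((\delta_H\circ\eta_H)\otimes(\delta_H\circ\eta_H))$; and there is an antipode $\lambda_H:H\to H$ with (a4) $id_H\ast\lambda_H=\Pi_H^L:=((\varepsilon_H\circ\mu_H)\otimes H)\circ(H\otimes c_{H,H})\circ((\delta_H\circ\eta_H)\otimes H)$, (a5) $\lambda_H\ast id_H=\Pi_H^R:=(H\otimes(\varepsilon_H\circ\mu_H))\circ(c_{H,H}\otimes H)\circ(H\otimes(\delta_H\circ\eta_H))$, (a6) $\lambda_H\ast id_H\ast\lambda_H=\lambda_H$. Actions. For an algebra $B$, a measuring is a morphism $\varphi_B:H\otimes B\to B$ with (b1) $\varphi_B\circ(H\otimes\mu_B)=\mu_B\circ(\varphi_B\otimes\varphi_B)\circ(H\otimes c_{H,B}\otimes B)\circ(\delta_H\otimes B\otimes B)$. Put $u_1^{\varphi_B}=\varphi_B\circ(H\otimes\eta_B)$. $(B,\varphi_B)$ is a left weak $H$-module algebra if moreover (b2) $\varphi_B\circ(\eta_H\otimes B)=id_B$ and (b3) $u_1^{\varphi_B}\circ\mu_H=\varphi_B\circ(H\otimes u_1^{\varphi_B})$; it is a left $H$-module algebra if (b3) is replaced by $\varphi_B\circ(\mu_H\otimes B)=\varphi_B\circ(H\otimes\varphi_B)$. For $n\ge 2$, $u_n^{\varphi_B}=u_1^{\varphi_B}\circ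 m_H^{\otimes n}$, where $m_H^{\otimes n}:H^{\otimes n}\to H$ is the iterated product. Regular morphisms. $Reg_{\varphi_B}(H^{\otimes n},B)$ is the group (under $\ast$, with unit $u_n^{\varphi_B}$) of morphisms $\sigma:H^{\otimes n}\to B$ for which there is $\sigma^{-1}:H^{\otimes n}\to B$ with $\sigma\ast\sigma^{-1}=\sigma^{-1}\ast\sigma=u_n^{\varphi_B}$, $\sigma\ast\sigma^{-1}\ast\sigma=\sigma$, $\sigma^{-1}\ast\sigma\ast\sigma^{-1}=\sigma^{-1}$. Conditions on $\sigma:H\otimes H\to B$. Let $P_{\varphi_B}=(\varphi_B\otimes H)\circ(H\otimes c_{H,B})\circ(\delta_H\otimes B)$ and $F_\sigma=(\sigma\otimes\mu_H)\circ\delta_{H\otimes H}$. Twisted condition: $\mu_B\circ(B\otimes\sigma)\circ(P_{\varphi_B}\otimes H)\circ(H\otimes P_{\varphi_B})=\mu_B\circ(B\otimes\varphi_B)\circ(F_\sigma\otimes B)$. Cocycle condition: $\mu_B\circ(B\otimes\sigma)\circ(P_{\varphi_B}\otimes H)\circ(H\otimes F_\sigma)=\mu_B\circ(B\otimes\sigma)\circ(F_\sigma\otimes H)$. Coface operators. $\partial_{2,i}:Reg_{\varphi_B}(H^{\otimes 2},B)\to Reg_{\varphi_B}(H^{\otimes3},B)$: $\partial_{2,0}(\sigma)=\varphi_B\circ(H\otimes\sigma)$, $\partial_{2,1}(\sigma)=\sigma\circ(\mu_H\otimes H)$, $\partial_{2,2}(\sigma)=\sigma\circ(H\otimes\mu_H)$,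 $\partial_{2,3}(\sigma)=\sigma\circ(H\otimes(\mu_H\circ(H\otimes\Pi_H^L)))$. For a commutative left $H$-module algebra $(A,\varphi_A)$ ($H$ cocommutative), $D^2_{\varphi_A}:Reg_{\varphi_A}(H^{\otimes2},A)\to Reg_{\varphi_A}(H^{\otimes3},A)$ is $D^2_{\varphi_A}(\tau)=\partial_{2,0}(\tau)\ast\partial_{2,1}(\tau)^{-1}\ast\partial_{2,2}(\tau)\ast\partial_{2,3}(\tau)^{-1}$, the coface operators being those of $(A,\varphi_A)$. Center. The center of $B$ is an object $Z(B)$ with a monomorphism $z_B:Z(B)\to B$ such that $\mu_B\circ(B\otimes z_B)=\mu_B\circ c_{B,B}\circ(B\otimes z_B)$ and every $f:A\to B$ with $\mu_B\circ(B\otimes f)=\mu_B\circ c_{B,B}\circ(B\otimes f)$ factors uniquely through $z_B$. It is assumed to exist; it is a commutative algebra and $z_B$ is an algebra morphism. When $H$ is cocommutative and some $\sigma\in Reg_{\varphi_B}(H^{\otimes2},B)$ satisfies the twisted condition, there is a unique $\varphi_{Z(B)}:H\otimes Z(B)\to Z(B)$ with $z_B\circ\varphi_{Z(B)}=\varphi_B\circ(H\otimes z_B)$, and $(Z(B),\varphi_{Z(B)})$ is a left $H$-module algebra. Obstruction. The pre-obstruction of $\sigma\in Reg_{\varphi_B}(H^{\otimes 2},B)$ is $\omega_\sigma=\partial_{2,0}(\sigma)\ast\partial_{2,2}(\sigma)\ast\partial_{2,1}(\sigma)^{-1}\ast\partial_{2,3}(\sigma)^{-1}:H^{\otimes3}\to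 B$. If $\sigma$ satisfies the twisted condition, $\omega_\sigma$ factors through the center, and the obstruction $\theta_\sigma:H^{\otimes3}\to Z(B)$ is the unique morphism with $z_B\circ\theta_\sigma=\omega_\sigma$. *)

(* Defs.v *)
From mathcomp Require Import all_boot.
From Stdlib Require Import ClassicalEpsilon.

Set Implicit Arguments.
Unset Strict Implicit.
Unset Printing Implicit Defensive.

Declare Scope smc_scope.
Delimit Scope smc_scope with smc.
Local Open Scope smc_scope.

Reserved Notation "g ∘ f" (at level 40, left associativity).
Reserved Notation "f ⊗ g" (at level 38, right associativity).
Reserved Notation "s ~> t" (at level 70, no associativity).

Definition casthom (O : Type) (hom : O -> O -> Type) (A A' B B' : O)
    (eA : A = A') (eB : B = B') (f : hom A B) : hom A' B' :=
  let: erefl := eA in let: erefl := eB in f.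

(* Strictness is Leibniz equality of objects, so the laws relating morphisms
   between objects that are only propositionally equal go through casthom. *)
Record ssmcat : Type := SSMCat {
  ob : Type;
  hom : ob -> ob -> Type;
  idm : forall A, hom A A;
  mcomp : forall A B C, hom B C -> hom A B -> hom A C;
  mcompA : forall A B C D (h : hom C D) (g : hom B C) (f : hom A B),
    mcomp h (mcomp g f) = mcomp (mcomp h g) f;
  mcomp1m : forall A B (f : hom A B), mcomp (idm B) f = f;
  mcompm1 : forall A B (f : hom A B), mcomp f (idm A) = f;
  tob : ob -> ob -> ob;
  uob : ob;
  tobA : forall A B C, tob A (tob B C) = tob (tob A B) C;
  tob1o : forall A, tob uob A = A;
  tobo1 : forall A, tob A uob = A;
  thom : forall A B A' B', hom A B -> hom A' B' -> hom (tob A A') (tob B B');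
  thom_id : forall A B, thom (idm A) (idm B) = idm (tob A B);
  thom_comp : forall A B C A' B' C' (g : hom B C) (f : hom A B)
      (g' : hom B' C') (f' : hom A' B'),
    thom (mcomp g f) (mcomp g' f') = mcomp (thom g g') (thom f f');
  thomA : forall A B A' B' A'' B'' (f : hom A B) (g : hom A' B')
      (h : hom A'' B''),
    casthom (tobA A A' A'') (tobA B B' B'') (thom f (thom g h))
    = thom (thom f g) h;
  thom1m : forall A B (f : hom A B),
    casthom (tob1o A) (tob1o B) (thom (idm uob) f) = f;
  thomm1 : forall A B (f : hom A B),
    casthom (tobo1 A) (tobo1 B) (thom f (idm uob)) = f;
  sym : forall A B, hom (tob A B) (tob B A);
  sym_nat : forall A B A' B' (f : hom A B) (g : hom A' B'),
    mcomp (sym B B') (thom f g) = mcomp (thom g f) (sym A A');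
  symK : forall A B, mcomp (sym B A) (sym A B) = idm (tob A B);
  sym_hexagon : forall A B C,
    sym A (tob B C)
    = casthom erefl (tobA B C A)
        (mcomp (thom (idm B) (sym A C))
              (casthom (esym (tobA A B C)) (esym (tobA B A C))
                 (thom (sym A B) (idm C))))
}.

Arguments idm {s} A.
Arguments mcomp {s A B C}.
Arguments tob {s}.
Arguments uob {s}.
Arguments thom {s A B A' B'}.
Arguments sym {s} A B.

Definition idempotents_split (C : ssmcat) : Prop :=
  forall (A : ob C) (e : hom A A), mcomp e e = e ->
  exists (X : ob C) (i : hom X A) (p : hom A X),
    mcomp p i = idm X /\ mcomp i p = e.

(* A tensor product of several objects is handled as the word of its factors:
   [:: A; B; C] stands for tob A (tob B C), [::] for the unit object and [:: A]
   for A itself.  On explicit words, concatenation is associative and unital by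
   computation, so formulas written with ⊗ below need no casts. *)
Section Words.

Variable C : ssmcat.
Implicit Types (s t : seq (ob C)).

Fixpoint tensor_word s : ob C :=
  if s is A :: s' then
    if s' is [::] then A else tob A (tensor_word s')
  else uob.

Lemma tensor_word_cat s t :
  tensor_word (s ++ t) = tob (tensor_word s) (tensor_word t).
Proof.
elim: s => [|A [|B s] IHs]; first exact: (esym (tob1o _)).
  by case: t {IHs} => [|B t]; [exact: (esym (tobo1 _)) | exact: erefl].
exact: (etrans (congr1 (tob A) IHs) (tobA _ _ _)).
Defined.

Definition whom s t : Type := hom (tensor_word s) (tensor_word t).

Definition wid s : whom s s := idm (tensor_word s).

Definition wcomp s t u (g : whom t u) (f : whom s t) : whom s u := mcomp g f.

Definition wtensor s t s' t' (f : whom s t) (g : whom s' t') :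
    whom (s ++ s') (t ++ t') :=
  casthom (esym (tensor_word_cat s s')) (esym (tensor_word_cat t t'))
    (thom f g).

Definition wsym s t : whom (s ++ t) (t ++ s) :=
  casthom (esym (tensor_word_cat s t)) (esym (tensor_word_cat t s))
    (sym (tensor_word s) (tensor_word t)).

End Words.

Arguments wid {C} s.
Arguments wcomp {C s t u}.
Arguments wtensor {C s t s' t'}.
Arguments wsym {C} s t.

Notation "s ~> t" := (whom s t) : smc_scope.
Notation "g ∘ f" := (wcomp g f) : smc_scope.
Notation "f ⊗ g" := (wtensor f g) : smc_scope.

Record algebra_on (C : ssmcat) (A : ob C) : Type := AlgebraOn {
  unit_of : [::] ~> [:: A];
  mul_of : [:: A; A] ~> [:: A];
  mul1l : mul_of ∘ (unit_of ⊗ wid [:: A]) = wid [:: A];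
  mul1r : mul_of ∘ (wid [:: A] ⊗ unit_of) = wid [:: A];
  mul_assoc : mul_of ∘ (mul_of ⊗ wid [:: A]) = mul_of ∘ (wid [:: A] ⊗ mul_of)
}.

Record coalgebra_on (C : ssmcat) (D : ob C) : Type := CoalgebraOn {
  counit_of : [:: D] ~> [::];
  comul_of : [:: D] ~> [:: D; D];
  comul1l : (counit_of ⊗ wid [:: D]) ∘ comul_of = wid [:: D];
  comul1r : (wid [:: D] ⊗ counit_of) ∘ comul_of = wid [:: D];
  comul_assoc :
    (comul_of ⊗ wid [:: D]) ∘ comul_of = (wid [:: D] ⊗ comul_of) ∘ comul_of
}.

Record algebra (C : ssmcat) : Type := Algebra {
  alg_ob :> ob C;
  alg_str : algebra_on alg_ob
}.

Definition aunit (C : ssmcat) (A : algebra C) : [::] ~> [:: alg_ob A] :=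
  unit_of (alg_str A).
Definition amul (C : ssmcat) (A : algebra C) :
    [:: alg_ob A; alg_ob A] ~> [:: alg_ob A] :=
  mul_of (alg_str A).

Definition algebra_morphism (C : ssmcat) (A B : algebra C)
    (f : [:: alg_ob A] ~> [:: alg_ob B]) : Prop :=
  f ∘ aunit A = aunit B /\ f ∘ amul A = amul B ∘ (f ⊗ f).

Definition convolution (C : ssmcat) (w : seq (ob C)) (A : ob C)
    (delta : w ~> w ++ w) (mu : [:: A; A] ~> [:: A]) (f g : w ~> [:: A]) :
    w ~> [:: A] :=
  mu ∘ (f ⊗ g) ∘ delta.

Section WeakHopfAxioms.

Variables (C : ssmcat) (H : ob C).
Variables (AH : algebra_on H) (DH : coalgebra_on H) (lambda : [:: H] ~> [:: H]).

Let eta := unit_of AH.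
Let mu := mul_of AH.
Let eps := counit_of DH.
Let delta := comul_of DH.
Let idH := wid [:: H].
Let cHH : [:: H; H] ~> [:: H; H] := wsym [:: H] [:: H].

Definition comul2 : [:: H; H] ~> [:: H; H; H; H] :=
  (idH ⊗ cHH ⊗ idH) ∘ (delta ⊗ delta).

Definition PiL : [:: H] ~> [:: H] :=
  ((eps ∘ mu) ⊗ idH) ∘ (idH ⊗ cHH) ∘ ((delta ∘ eta) ⊗ idH).

Definition PiR : [:: H] ~> [:: H] :=
  (idH ⊗ (eps ∘ mu)) ∘ (cHH ⊗ idH) ∘ (idH ⊗ (delta ∘ eta)).

Record weak_hopf_axioms : Prop := WeakHopfAxioms {
  wh_comul_mul : delta ∘ mu = (mu ⊗ mu) ∘ comul2;
  wh_counit_mul :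
    eps ∘ mu ∘ (mu ⊗ idH)
    = ((eps ∘ mu) ⊗ (eps ∘ mu)) ∘ (idH ⊗ delta ⊗ idH);
  wh_counit_mul_op :
    eps ∘ mu ∘ (mu ⊗ idH)
    = ((eps ∘ mu) ⊗ (eps ∘ mu)) ∘ (idH ⊗ (cHH ∘ delta) ⊗ idH);
  wh_comul_unit :
    (delta ⊗ idH) ∘ delta ∘ eta
    = (idH ⊗ mu ⊗ idH) ∘ ((delta ∘ eta) ⊗ (delta ∘ eta));
  wh_comul_unit_op :
    (delta ⊗ idH) ∘ delta ∘ eta
    = (idH ⊗ (mu ∘ cHH) ⊗ idH) ∘ ((delta ∘ eta) ⊗ (delta ∘ eta));
  wh_antipodeL : convolution delta mu idH lambda = PiL;
  wh_antipodeR : convolution delta mu lambda idH = PiR;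
  wh_antipode :
    convolution delta mu (convolution delta mu lambda idH) lambda = lambda
}.

End WeakHopfAxioms.

Record weak_hopf (C : ssmcat) : Type := WeakHopf {
  wh_ob :> ob C;
  wh_alg : algebra_on wh_ob;
  wh_coalg : coalgebra_on wh_ob;
  wh_lambda : [:: wh_ob] ~> [:: wh_ob];
  wh_axioms : weak_hopf_axioms wh_alg wh_coalg wh_lambda
}.

Definition cocommutative (C : ssmcat) (H : weak_hopf C) : Prop :=
  wsym [:: wh_ob H] [:: wh_ob H] ∘ comul_of (wh_coalg H)
  = comul_of (wh_coalg H).

Section Actions.

Variables (C : ssmcat) (H : weak_hopf C) (B : algebra C).
Variable phi : [:: wh_ob H; alg_ob B] ~> [:: alg_ob B].

Let h : ob C := H.
Let b : ob C := B.
Let etaH : [::] ~> [:: h] := unit_of (wh_alg H).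
Let muH : [:: h; h] ~> [:: h] := mul_of (wh_alg H).
Let deltaH : [:: h] ~> [:: h; h] := comul_of (wh_coalg H).
Let etaB : [::] ~> [:: b] := aunit B.
Let muB : [:: b; b] ~> [:: b] := amul B.
Let idH := wid [:: h].
Let idB := wid [:: b].
Let cHB : [:: h; b] ~> [:: b; h] := wsym [:: h] [:: b].

Definition measuring : Prop :=
  phi ∘ (idH ⊗ muB)
  = muB ∘ (phi ⊗ phi) ∘ (idH ⊗ cHB ⊗ idB) ∘ (deltaH ⊗ idB ⊗ idB).

Definition u1 : [:: h] ~> [:: b] := phi ∘ (idH ⊗ etaB).
Definition u2 : [:: h; h] ~> [:: b] := u1 ∘ muH.
Definition u3 : [:: h; h; h] ~> [:: b] := u1 ∘ (muH ∘ (muH ⊗ idH)).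

Definition weak_module_algebra : Prop :=
  [/\ measuring,
      phi ∘ (etaH ⊗ idB) = idB
    & u1 ∘ muH = phi ∘ (idH ⊗ u1)].

Definition deltaHH : [:: h; h] ~> [:: h; h; h; h] := comul2 (wh_coalg H).

(* delta_{D ⊗ E} for D = H and E = H ⊗ H *)
Definition deltaHHH : [:: h; h; h] ~> [:: h; h; h; h; h; h] :=
  (idH ⊗ wsym [:: h] [:: h; h] ⊗ wid [:: h; h]) ∘ (deltaH ⊗ deltaHH).

Section Regular.

Variables (w : seq (ob C)) (delta : w ~> w ++ w) (u : w ~> [:: b]).

Definition regular_inverse (f g : w ~> [:: b]) : Prop :=
  [/\ convolution delta muB f g = u,
      convolution delta muB g f = u,
      convolution delta muB (convolution delta muB f g) f = f
    & convolution delta muB (convolution delta muB g f) g = g].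

Definition regular (f : w ~> [:: b]) : Prop :=
  exists g, regular_inverse f g.

(* The group inverse of a regular f, which is unique; junk otherwise. *)
Definition conv_inv (f : w ~> [:: b]) : w ~> [:: b] :=
  epsilon (inhabits u) (regular_inverse f).

End Regular.

Definition Reg2 : ([:: h; h] ~> [:: b]) -> Prop := regular deltaHH u2.
Definition Reg3 : ([:: h; h; h] ~> [:: b]) -> Prop := regular deltaHHH u3.

Definition conv3 : ([:: h; h; h] ~> [:: b]) -> ([:: h; h; h] ~> [:: b]) ->
    ([:: h; h; h] ~> [:: b]) := convolution deltaHHH muB.
Definition inv3 : ([:: h; h; h] ~> [:: b]) -> ([:: h; h; h] ~> [:: b]) :=
  conv_inv deltaHHH u3.

Definition P_phi : [:: h; b] ~> [:: b; h] :=
  (phi ⊗ idH) ∘ (idH ⊗ cHB) ∘ (deltaH ⊗ idB).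

Section OnSigma.

Variable sigma : [:: h; h] ~> [:: b].

Definition F_sigma : [:: h; h] ~> [:: b; h] := (sigma ⊗ muH) ∘ deltaHH.

Definition twisted_condition : Prop :=
  muB ∘ (idB ⊗ sigma) ∘ (P_phi ⊗ idH) ∘ (idH ⊗ P_phi)
  = muB ∘ (idB ⊗ phi) ∘ (F_sigma ⊗ idB).

Definition cocycle_condition : Prop :=
  muB ∘ (idB ⊗ sigma) ∘ (P_phi ⊗ idH) ∘ (idH ⊗ F_sigma)
  = muB ∘ (idB ⊗ sigma) ∘ (F_sigma ⊗ idH).

Definition coface0 : [:: h; h; h] ~> [:: b] := phi ∘ (idH ⊗ sigma).
Definition coface1 : [:: h; h; h] ~> [:: b] := sigma ∘ (muH ⊗ idH).
Definition coface2 : [:: h; h; h] ~> [:: b] := sigma ∘ (idH ⊗ muH).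
Definition coface3 : [:: h; h; h] ~> [:: b] :=
  sigma ∘ (idH ⊗ (muH ∘ (idH ⊗ PiL (wh_alg H) (wh_coalg H)))).

Definition D2 : [:: h; h; h] ~> [:: b] :=
  conv3 (conv3 (conv3 coface0 (inv3 coface1)) coface2) (inv3 coface3).

Definition pre_obstruction : [:: h; h; h] ~> [:: b] :=
  conv3 (conv3 (conv3 coface0 coface2) (inv3 coface1)) (inv3 coface3).

End OnSigma.

Definition in_Im_D2 (theta : [:: h; h; h] ~> [:: b]) : Prop :=
  exists tau, Reg2 tau /\ D2 tau = theta.

End Actions.

Definition central (C : ssmcat) (B : algebra C) (A : ob C)
    (f : [:: A] ~> [:: alg_ob B]) : Prop :=
  amul B ∘ (wid [:: alg_ob B] ⊗ f)
  = amul B ∘ wsym [:: alg_ob B] [:: alg_ob B] ∘ (wid [:: alg_ob B] ⊗ f).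

Definition monomorphism (C : ssmcat) (A B : ob C) (z : [:: A] ~> [:: B]) :
    Prop :=
  forall (X : ob C) (f g : [:: X] ~> [:: A]), z ∘ f = z ∘ g -> f = g.

(* The algebra structure on Z is the unique one making z multiplicative and
   unital; it is carried as data rather than built from the universal
   property. *)
Definition is_center (C : ssmcat) (B Z : algebra C)
    (z : [:: alg_ob Z] ~> [:: alg_ob B]) : Prop :=
  [/\ monomorphism z, central z,
      forall (A : ob C) (f : [:: A] ~> [:: alg_ob B]), central f ->
        exists! f' : [:: A] ~> [:: alg_ob Z], z ∘ f' = f
    & algebra_morphism z].

(* Main.v *)
Require Import Defs.
From mathcomp Require Import all_boot.
From mathcomp Require Import zify.
From Stdlib Require Import ClassicalEpsilon Classical_Prop.

Local Open Scope smc_scope.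

(** Why the theorem holds.  Let D be a cocommutative coalgebra.  Morphisms from D
    to B multiply by convolution, every comultiplicative q from D to H makes H
    act on them multiplicatively, and cocommutativity lets one write formulas
    at a point x of D without Sweedler indices.  At points q and r of H the
    twisted condition for σ reads q(rb) σ(q,r) = σ(q,r) ((qr)b): conjugation by
    σ measures how far the action is from being associative ([Act_twisted]).

    Let σ and α both be regular and twisted.  Then the quotient f = σ^{-1} ∗ α
    commutes with every value (qr)b of the action.  The antipode makes every
    element of B such a value, up to conjugation and up to the central factor
    u(x) = x1, so f is central ([quotient_commutes]); conversely σ ∗ f is
    twisted for every central regular f ([twisted_mul]).  The centrality of
    u, and the fact that x(λ(x)b) is a conjugate of u(x)b, rest on identities
    for Π^L and on the antipode being comultiplicative ([antipode_comul]).

    On H ⊗ H ⊗ H all cofaces of regular morphisms are regular for the same unit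
    u(xyz), and the cocycle condition becomes ∂0 ∗ ∂2 = ∂3 ∗ ∂1 in the group of
    regular morphisms ([cocycleP]).  Cofaces are multiplicative, and those of a
    central f are central.  So in the cocycle condition for σ ∗ f the factors
    coming from f can be collected on one side: it holds exactly when the
    obstruction of σ is the coboundary of f^{-1} ([cocycle_of_coboundary],
    [coboundary_of_cocycle]).  Corestriction to the center turns f into a
    morphism with values in the center and back.

    Equalities of string diagrams are decided by reflection.  A diagram is
    compiled to a program on named wires, each instruction being a generator
    with its input and output wires, and two programs denote the same morphism
    when one is a reordering of the other that respects the dependencies.  The
    soundness of this test ([same_diagram_sound]) is a coherence theorem: the
    wires are sorted by adjacent swaps, and every reordering of distinct wires
    is absorbed by the sorting.  The steps that use a law of the algebras are
    rewritten in a redrawn diagram (tactics [diagram] and [redraw]). *)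

Set Implicit Arguments.
Unset Strict Implicit.
Unset Printing Implicit Defensive.

(** * Untyped arrows *)

Section Arrows.
Variable C : ssmcat.
Local Notation word := (seq (ob C)).

(** Words are associative only up to a propositional equality, so laws between
    typed morphisms need casts.  Packing the endpoints with the morphism turns
    these laws into plain equations with side conditions on the endpoints. *)
Record arr := Arr { dom : word; cod : word; body : whom dom cod }.
Arguments Arr {dom cod} body.

Lemma Arr_inj s t (f g : whom s t) : Arr f = Arr g -> f = g.
Proof.
move=> e.
have := congr1 (fun a => existT (fun p => whom p.1 p.2) (dom a, cod a) (body a)) e.
move=> /= e'; exact: inj_pair2 e'.
Qed.

Definition idA (s : word) : arr := Arr (wid s).
Definition symA (s t : word) : arr := Arr (wsym s t).
Definition atens (a b : arr) : arr := Arr (body a ⊗ body b).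

(** Composability means that two words of objects are equal, which only
    excluded middle can decide. *)
Definition acomp (b a : arr) : arr :=
  match excluded_middle_informative (cod a = dom b) with
  | left e => Arr (body b ∘ eq_rect (cod a) (whom (dom a)) (body a) (dom b) e)
  | right _ => a
  end.

Lemma compE s t u (g : whom t u) (f : whom s t) :
  Arr (g ∘ f) = acomp (Arr g) (Arr f).
Proof.
rewrite /acomp /=; case: excluded_middle_informative => [e|[]] //.
by rewrite (proof_irrelevance _ e erefl).
Qed.

Lemma tensE s t s' t' (f : whom s t) (g : whom s' t') :
  Arr (f ⊗ g) = atens (Arr f) (Arr g).
Proof. by []. Qed.

Lemma arr_ind2 (P : arr -> arr -> Prop) :
  (forall s t u (g : whom t u) (f : whom s t), P (Arr g) (Arr f)) ->
  forall b a, cod a = dom b -> P b a.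
Proof.
move=> H [t u g] [s t' f] /= e; case: _ / e g => g; exact: H.
Qed.

Lemma dom_comp b a : dom (acomp b a) = dom a.
Proof. by rewrite /acomp; case: excluded_middle_informative. Qed.

Lemma cod_comp b a : cod a = dom b -> cod (acomp b a) = cod b.
Proof. by rewrite /acomp; case: excluded_middle_informative. Qed.

Lemma acompA c b a : cod a = dom b -> cod b = dom c ->
  acomp c (acomp b a) = acomp (acomp c b) a.
Proof.
move=> e; move: b a e c; apply: arr_ind2 => s t u g f [u' v h] /= e.
case: _ / e h => h; rewrite -!compE; congr Arr; exact: mcompA.
Qed.

Lemma comp1a a s : cod a = s -> acomp (idA s) a = a.
Proof. by case: a => s' t f /= <-; rewrite -compE; congr Arr; apply: mcomp1m. Qed.

Lemma compa1 a s : dom a = s -> acomp a (idA s) = a.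
Proof. by case: a => s' t f /= <-; rewrite -compE; congr Arr; apply: mcompm1. Qed.

Lemma Arr_cast s t s' t' (es : s = s') (et : t = t') (f : whom s t) :
  Arr (casthom (hom := @whom C) es et f) = Arr f.
Proof. by case: _ / es; case: _ / et. Qed.

(** Forgets how the endpoints are factored into words: the laws of [ssmcat] are
    about hom-sets, and [raw_cast] erases their casts. *)
Definition raw (X Y : ob C) (f : hom X Y) : {p : ob C * ob C & hom p.1 p.2} :=
  existT (fun p : ob C * ob C => hom p.1 p.2) (X, Y) f.

Lemma raw_cast X Y X' Y' (eX : X = X') (eY : Y = Y') (f : hom X Y) :
  raw (casthom eX eY f) = raw f.
Proof. by case: _ / eX; case: _ / eY. Qed.

Lemma Arr_raw s t s' t' (f : whom s t) (g : whom s' t') :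
  s = s' -> t = t' -> raw f = raw g -> Arr f = Arr g.
Proof.
move=> es et; case: _ / es g => g; case: _ / et g => g.
by move=> e; congr Arr; apply: inj_pair2 e.
Qed.

Lemma raw_thom X Y X1 Y1 X' Y' X1' Y1' (f : hom X Y) (f1 : hom X1 Y1)
    (g : hom X' Y') (g1 : hom X1' Y1') :
  raw f = raw f1 -> raw g = raw g1 -> raw (thom f g) = raw (thom f1 g1).
Proof.
move=> e e'.
have [eX eY] := (congr1 (fun x => (projT1 x).1) e, congr1 (fun x => (projT1 x).2) e).
have [eX' eY'] :=
  (congr1 (fun x => (projT1 x).1) e', congr1 (fun x => (projT1 x).2) e').
move: eX eY eX' eY' => /= eX eY eX' eY'.
case: _ / eX f1 e => f1; case: _ / eY f1 => f1 e.
case: _ / eX' g1 e' => g1; case: _ / eY' g1 => g1 e'.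
by rewrite (inj_pair2 _ _ _ _ _ e) (inj_pair2 _ _ _ _ _ e').
Qed.

Lemma raw_comp X Y Z X1 Y1 Z1 (g : hom Y Z) (f : hom X Y)
    (g1 : hom Y1 Z1) (f1 : hom X1 Y1) :
  raw f = raw f1 -> raw g = raw g1 -> raw (mcomp g f) = raw (mcomp g1 f1).
Proof.
move=> e e'.
have [eX eY] := (congr1 (fun x => (projT1 x).1) e, congr1 (fun x => (projT1 x).2) e).
have eZ := congr1 (fun x => (projT1 x).2) e'.
move: eX eY eZ => /= eX eY eZ.
case: _ / eX f1 e => f1; case: _ / eY f1 g1 e' => f1 g1 e' e.
case: _ / eZ g1 e' => g1 e'.
by rewrite (inj_pair2 _ _ _ _ _ e) (inj_pair2 _ _ _ _ _ e').
Qed.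

Lemma raw_tensor s t s' t' (f : whom s t) (g : whom s' t') :
  raw (f ⊗ g : hom _ _) = raw (thom f g).
Proof. exact: raw_cast. Qed.

Lemma tensA a b c : atens a (atens b c) = atens (atens a b) c.
Proof.
case: a b c => [s t f] [s' t' g] [s'' t'' h].
rewrite -!tensE; apply: Arr_raw; rewrite ?catA ?raw_tensor //.
apply: etrans (raw_thom (erefl _) (raw_tensor g h)) _.
apply: etrans _ (esym (raw_thom (raw_tensor f g) (erefl _))).
by rewrite -thomA raw_cast.
Qed.

Lemma tens1a a : atens (idA [::]) a = a.
Proof.
case: a => [s t f]; rewrite -(tensE (wid [::])); apply: Arr_raw => //.
by rewrite raw_tensor -[in RHS](thom1m f) raw_cast.
Qed.

Lemma tensa1 a : atens a (idA [::]) = a.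
Proof.
case: a => [s t f]; rewrite -(tensE f (wid [::])); apply: Arr_raw; rewrite ?cats0 //.
by rewrite raw_tensor -[in RHS](thomm1 f) raw_cast.
Qed.

Lemma raw_idm X Y : X = Y -> raw (idm X) = raw (idm Y).
Proof. by move=> ->. Qed.

Lemma raw_sym X Y X' Y' : X = X' -> Y = Y' -> raw (sym X Y) = raw (sym X' Y').
Proof. by move=> -> ->. Qed.

Lemma tens_id s t : atens (idA s) (idA t) = idA (s ++ t).
Proof.
rewrite -(tensE (wid s) (wid t)); apply: Arr_raw => //; rewrite raw_tensor thom_id.
by apply: raw_idm; rewrite tensor_word_cat.
Qed.

Lemma tens_comp b a b' a' : cod a = dom b -> cod a' = dom b' ->
  atens (acomp b a) (acomp b' a') = acomp (atens b b') (atens a a').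
Proof.
move=> e e'; move: b a e b' a' e'; apply: arr_ind2 => s t u g f.
apply: arr_ind2 => s' t' u' g' f'.
rewrite -!compE -tensE; apply: Arr_raw => //=; rewrite raw_tensor.
rewrite [RHS](raw_comp (f1 := thom f f') (g1 := thom g g')) ?raw_tensor //.
by rewrite -thom_comp.
Qed.

Lemma sym_natural a b :
  acomp (symA (cod a) (cod b)) (atens a b) = acomp (atens b a) (symA (dom a) (dom b)).
Proof.
case: a b => [s t f] [s' t' g] /=; rewrite -!tensE -!compE.
apply: Arr_raw => //.
rewrite (raw_comp (f1 := thom f g) (g1 := sym _ _)) ?raw_tensor ?raw_cast //.
rewrite [RHS](raw_comp (g1 := thom g f) (f1 := sym _ _)) ?raw_tensor ?raw_cast //.
by rewrite sym_nat.
Qed.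

Lemma symAK s t : acomp (symA t s) (symA s t) = idA (s ++ t).
Proof.
rewrite -compE; apply: Arr_raw => //.
apply: etrans (raw_comp (f1 := sym (tensor_word s) (tensor_word t))
  (g1 := sym (tensor_word t) (tensor_word s)) _ _) _; rewrite ?raw_cast // symK.
by apply: raw_idm; rewrite tensor_word_cat.
Qed.

Lemma sym_hex s t u :
  symA s (t ++ u) = acomp (atens (idA t) (symA s u)) (atens (symA s t) (idA u)).
Proof.
rewrite -!tensE -(Arr_cast (esym (catA s t u)) (esym (catA t s u))) -compE.
apply: Arr_raw; rewrite -?catA // raw_cast.
rewrite (raw_sym (erefl _) (tensor_word_cat _ _)) sym_hexagon raw_cast.
apply: esym; apply: raw_comp; last first.
  by rewrite raw_tensor; apply: raw_thom; rewrite ?raw_cast.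
have raw_wcast x y x' y' (e : x = x') (e' : y = y') (f : whom x y) :
  raw (casthom (hom := @whom C) e e' f : hom _ _) = raw (f : hom _ _).
  by case: _ / e; case: _ / e'.
rewrite raw_wcast raw_tensor raw_cast.
by apply: raw_thom; rewrite ?raw_cast.
Qed.

(** The hexagon makes [symA s [::]] idempotent, and it is invertible. *)
Lemma sym_nil s : symA s [::] = idA s.
Proof.
have E : dom (symA s [::]) = s by rewrite /= cats0.
have h := sym_hex s [::] [::].
rewrite tens1a tensa1 in h.
have hK : acomp (symA [::] s) (symA s [::]) = idA s by rewrite symAK cats0.
rewrite -[LHS](comp1a (s := s)) // -{1}hK -acompA /= ?cats0 //.
by rewrite -[X in acomp _ X]h hK.
Qed.

End Arrows.

(* Unification must not unfold the case analysis in [acomp]. *)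
#[global] Opaque acomp.

(** * Coherence for reordering distinct wires *)

(** Side conditions on endpoints are computed.  Equations between arrows are
    refused: closing them by conversion can take forever. *)
Ltac solve_ends ends :=
  match goal with |- @eq (arr _) _ _ => fail 1 | _ => idtac end;
  solve [repeat first
  [ reflexivity
  | progress rewrite /= ?ends ?map_cat -?catA ?cats0
  | match goal with
    | e : cod ?a = _ |- context [cod ?a] => rewrite e
    | e : dom ?a = _ |- context [dom ?a] => rewrite e
    end
  | rewrite cod_comp]].

Section Coherence.
Variables (C : ssmcat) (ty : nat -> ob C).
Local Notation T := (map ty).
Implicit Types (x y z : nat) (l ws : seq nat).
Local Notation "b ∙ a" := (acomp b a) (at level 40, left associativity).
Local Notation "a ⊠ b" := (atens a b) (at level 38, right associativity).

Local Notation idw ws := (idA (T ws)).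
Definition swap x y : arr C := symA [:: ty x] [:: ty y].

Lemma dom_tens (a b : arr C) : dom (a ⊠ b) = dom a ++ dom b. Proof. by []. Qed.
Lemma cod_tens (a b : arr C) : cod (a ⊠ b) = cod a ++ cod b. Proof. by []. Qed.

Fixpoint insw x l : seq nat :=
  if l is y :: l' then if x < y then x :: l else y :: insw x l' else [:: x].

Definition sortw : seq nat -> seq nat := foldr insw [::].

Fixpoint ins x l : arr C :=
  if l is y :: l' then
    if x < y then idw (x :: l)
    else (idw [:: y] ⊠ ins x l') ∙ (swap x y ⊠ idw l')
  else idw [:: x].

(** Sorting by adjacent swaps gives every reordering of distinct wires one
    preferred arrow.  Coherence then says that a block swap before sorting is
    absorbed, as proved in [absorbs_disjoint]. *)
Fixpoint sortm ws : arr C :=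
  if ws is x :: l then ins x (sortw l) ∙ (idw [:: x] ⊠ sortm l) else idw [::].

Arguments ins : simpl never.

Lemma dom_ins x l : dom (ins x l) = T (x :: l).
Proof. by case: l => //= y l; rewrite /ins; case: ifP => //= _; rewrite dom_comp. Qed.

Lemma cod_ins x l : cod (ins x l) = T (insw x l).
Proof.
elim: l => //= y l IH; rewrite /ins; case: ifP => //= _; rewrite -/ins.
by rewrite cod_comp /= ?IH ?dom_ins.
Qed.

Lemma dom_sortm ws : dom (sortm ws) = T ws.
Proof. by elim: ws => //= x l IH; rewrite dom_comp /= IH. Qed.

Lemma cod_sortm ws : cod (sortm ws) = T (sortw ws).
Proof. by elim: ws => //= x l IH; rewrite cod_comp ?cod_ins //= dom_ins /= IH. Qed.

Definition ends :=
  (dom_tens, cod_tens, dom_comp, dom_ins, cod_ins, dom_sortm, cod_sortm).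

Lemma swapK x y : swap y x ∙ swap x y = idw [:: x; y].
Proof. exact: symAK. Qed.

Lemma tens_compl (b a : arr C) s : cod a = dom b ->
  (b ∙ a) ⊠ idA s = (b ⊠ idA s) ∙ (a ⊠ idA s).
Proof. by move=> e; rewrite -tens_comp // comp1a. Qed.

Lemma tens_compr (b a : arr C) s : cod a = dom b ->
  idA s ⊠ (b ∙ a) = (idA s ⊠ b) ∙ (idA s ⊠ a).
Proof. by move=> e; rewrite -tens_comp // comp1a. Qed.

Lemma interchange (a b : arr C) :
  (a ⊠ idA (cod b)) ∙ (idA (dom a) ⊠ b) = (idA (cod a) ⊠ b) ∙ (a ⊠ idA (dom b)).
Proof. by rewrite -!tens_comp // !comp1a // !compa1. Qed.

(** The symmetry is natural with respect to itself. *)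
Lemma yang_baxter x y z :
  (swap y z ⊠ idw [:: x]) ∙ (idw [:: y] ⊠ swap x z) ∙ (swap x y ⊠ idw [:: z])
  = (idw [:: z] ⊠ swap x y) ∙ (swap x z ⊠ idw [:: y]) ∙ (idw [:: x] ⊠ swap y z).
Proof.
have h := sym_natural (idA [:: ty x]) (symA [:: ty y] [:: ty z]).
rewrite /= (sym_hex [:: ty x] [:: ty z] [:: ty y]) in h.
rewrite [X in _ = _ ∙ X](sym_hex [:: ty x] [:: ty y] [:: ty z]) in h.
by rewrite -acompA.
Qed.

Ltac by_ends := solve_ends ends.

Lemma ins_ge u v w : (u < v) = false ->
  ins u (v :: w) = idw [:: v] ⊠ ins u w ∙ swap u v ⊠ idw w.
Proof. by rewrite /ins -/ins => ->. Qed.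

Lemma insw_ge u v w : (u < v) = false -> insw u (v :: w) = v :: insw u w.
Proof. by move=> /= ->. Qed.

Lemma ins_lt u v w : u < v -> ins u (v :: w) = idw [:: u, v & w].
Proof. by rewrite /ins => ->. Qed.

Lemma swap_pass y z m (A : arr C) : cod A = ty z :: dom m ->
  swap y z ⊠ idA (cod m) ∙ idw [:: y] ⊠ (idw [:: z] ⊠ m ∙ A)
  = idw [:: z] ⊠ (idw [:: y] ⊠ m) ∙ (swap y z ⊠ idA (dom m) ∙ idw [:: y] ⊠ A).
Proof.
move=> eA; rewrite tens_compr // acompA //= ?eA // [RHS]acompA //= ?eA //.
congr (_ ∙ _).
by rewrite !tensA !tens_id (interchange (swap y z) m).
Qed.

(** Two wires inserted in either order give the same arrow up to their swap.
    When both have to pass the head [z], there are three crossings, and the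
    Yang-Baxter equation moves the crossing of [x] and [y] past [z]. *)
Lemma insK_lt x y l : x < y ->
  ins y (insw x l) ∙ idw [:: y] ⊠ ins x l ∙ swap x y ⊠ idw l
  = ins x (insw y l) ∙ idw [:: x] ⊠ ins y l.
Proof.
move=> lt; have yx : (y < x) = false by lia.
elim: l => [|z l IH].
  rewrite (ins_ge _ yx) (ins_lt _ lt) /= /ins !tensa1 !tens_id !comp1a ?compa1 //=.
  exact: swapK.
case: (ltnP x z) => [ltz|gez].
  have -> : insw x (z :: l) = x :: z :: l by rewrite /= ltz.
  have -> : ins x (insw y (z :: l)) = idw (x :: insw y (z :: l)).
    by rewrite /=; case: (ltnP y z) => ?; rewrite ins_lt.
  rewrite (ins_lt _ ltz) (ins_ge _ yx) tens_id compa1; last by_ends.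
  rewrite -acompA; try by_ends.
  rewrite -tens_compl // swapK tens_id compa1 ?comp1a //=; by_ends.
have xz : (x < z) = false by lia.
have yz : (y < z) = false by lia.
rewrite !(insw_ge _ xz) !(insw_ge _ yz) !(ins_ge _ xz) !(ins_ge _ yz).
have pass u v : (u < z) = false -> (v < z) = false ->
    idw [:: z] ⊠ ins u (insw v l) ∙ swap u z ⊠ idw (insw v l)
      ∙ idw [:: u] ⊠ (idw [:: z] ⊠ ins v l ∙ swap v z ⊠ idw l)
    = idw [:: z] ⊠ (ins u (insw v l) ∙ idw [:: u] ⊠ ins v l)
      ∙ ((swap u z ⊠ idw [:: v] ∙ idw [:: u] ⊠ swap v z) ⊠ idw l).
  move=> uz vz; have := @swap_pass u z (ins v l) (swap v z ⊠ idw l).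
  rewrite !ends => /(_ erefl) e.
  rewrite -acompA ?e; try by_ends.
  rewrite tens_compl // -!tensA tens_id tens_compr; last by_ends.
  by rewrite acompA; try by_ends.
rewrite !pass // -IH [in RHS]tens_compr; last by_ends.
rewrite -[LHS]acompA; try by_ends.
rewrite -[RHS]acompA; try by_ends.
congr (_ ∙ _).
rewrite (_ : swap x y ⊠ idw (z :: l) = (swap x y ⊠ idw [:: z]) ⊠ idw l); last first.
  by rewrite -tensA tens_id.
rewrite (_ : idw [:: z] ⊠ swap x y ⊠ idw l
           = (idw [:: z] ⊠ swap x y) ⊠ idw l); last by rewrite -tensA.
rewrite -[LHS]tens_compl; try by_ends.
rewrite -[RHS]tens_compl; try by_ends.
by rewrite yang_baxter -acompA; try by_ends.
Qed.

Lemma insK x y l : x != y ->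
  ins y (insw x l) ∙ idw [:: y] ⊠ ins x l ∙ swap x y ⊠ idw l
  = ins x (insw y l) ∙ idw [:: x] ⊠ ins y l.
Proof.
case: (ltngtP x y) => // lt _; first exact: insK_lt.
rewrite -(insK_lt l lt) -acompA; try by_ends.
rewrite -tens_compl // swapK tens_id compa1 //; by_ends.
Qed.

Definition iso (a : arr C) : Prop := exists b,
  [/\ dom b = cod a, cod b = dom a, b ∙ a = idA (dom a) & a ∙ b = idA (cod a)].

Lemma iso_id s : iso (idA s).
Proof. by exists (idA s); rewrite comp1a. Qed.

Lemma iso_swap x y : iso (swap x y).
Proof. by exists (swap y x); rewrite !swapK. Qed.

Lemma iso_tens (a b : arr C) : iso a -> iso b -> iso (a ⊠ b).
Proof.
case=> a' [da ca aK Ka] [b' [db cb bK Kb]]; exists (a' ⊠ b').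
by rewrite !ends da db ca cb -!tens_comp // aK bK Ka Kb !tens_id.
Qed.

Lemma iso_comp (a b : arr C) : cod a = dom b -> iso a -> iso b -> iso (b ∙ a).
Proof.
move=> e [a' [da ca aK Ka]] [b' [db cb bK Kb]]; exists (a' ∙ b').
have e' : cod b' = dom a' by rewrite cb da.
rewrite !dom_comp !cod_comp // db ca; split=> //.
  rewrite -acompA ?cod_comp ?db // (acompA (c := b')) ?db //.
  by rewrite bK comp1a.
rewrite -acompA ?cod_comp ?e' ?da // (acompA (c := a)) ?da ?e' //.
by rewrite Ka comp1a // cb.
Qed.

Lemma iso_ins x l : iso (ins x l).
Proof.
elim: l => [|y l IH]; first exact: iso_id.
case xy: (x < y); first by rewrite ins_lt //; apply: iso_id.
rewrite ins_ge //; apply: iso_comp; first by_ends.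
  by apply: iso_tens; [exact: iso_swap | exact: iso_id].
by apply: iso_tens => //; exact: iso_id.
Qed.

Lemma iso_sortm ws : iso (sortm ws).
Proof.
elim: ws => [|x l IH]; first exact: iso_id.
apply: iso_comp; [by_ends | | exact: iso_ins].
by apply: iso_tens => //; exact: iso_id.
Qed.

Lemma iso_inj (a m m' : arr C) : iso a -> cod m = dom a -> cod m' = dom a ->
  a ∙ m = a ∙ m' -> m = m'.
Proof.
case=> b [db cb bK Kb] e e' h.
by rewrite -(comp1a e) -(comp1a e') -bK -!acompA // h.
Qed.

Lemma perm_insw x l : perm_eq (insw x l) (x :: l).
Proof.
elim: l => //= y l IH; case: ifP => // _.
by rewrite (perm_trans (y := y :: x :: l)) ?perm_cons // (perm_catCA [:: y] [:: x] l).
Qed.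

Lemma perm_sortw ws : perm_eq (sortw ws) ws.
Proof.
elim: ws => //= x l IH; apply: perm_trans (perm_insw _ _) _.
by rewrite perm_cons.
Qed.

Lemma sorted_insw x l : sorted leq l -> sorted leq (insw x l).
Proof.
elim: l => //= y l IH; case: ltnP => [lt s|ge s] /=; first by rewrite ltnW.
have := IH (path_sorted s); case: l s {IH} => [|z l] /= s; first by rewrite ge.
by case: ifP => _ /= -> ; rewrite ?ge ?andbT //; case/andP: s => ->.
Qed.

Lemma sorted_sortw ws : sorted leq (sortw ws).
Proof. by elim: ws => //= x l; exact: sorted_insw. Qed.

Lemma sortw_perm ws ws' : perm_eq ws ws' -> sortw ws = sortw ws'.
Proof.
move=> e; apply: (sorted_eq leq_trans anti_leq); rewrite ?sorted_sortw //.
rewrite (perm_trans (perm_sortw _)) // perm_sym.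
by rewrite (perm_trans (perm_sortw _)) // perm_sym.
Qed.

Lemma sortm_sorted ws : sorted leq ws -> uniq ws ->
  sortw ws = ws /\ sortm ws = idw ws.
Proof.
elim: ws => //= x l IH s /andP[xl ul]; have [-> ->] := IH (path_sorted s) ul.
rewrite tens_id.
case: l s xl {IH ul} => [|y l] /=; first by rewrite compa1.
rewrite in_cons negb_or => /andP[le _] /andP[ne _].
have lt : x < y by rewrite ltn_neqAle ne.
by rewrite ins_lt ?lt //= comp1a.
Qed.

(** The wires of [r] can be put in a canonical order while those of [a] wait in
    front, ready for a generator. *)
Lemma sortm_cat a r : uniq r ->
  sortm (a ++ r) = sortm (a ++ sortw r) ∙ (idw a ⊠ sortm r).
Proof.
move=> ur; elim: a => [|x a IH] /=.
  rewrite tens1a; have [||_ ->] := @sortm_sorted (sortw r).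
  - exact: sorted_sortw.
  - by rewrite (perm_uniq (perm_sortw r)).
  by rewrite comp1a // cod_sortm.
have e : sortw (a ++ sortw r) = sortw (a ++ r).
  by apply: sortw_perm; rewrite perm_cat2l perm_sortw.
rewrite IH e -acompA; try by_ends.
rewrite -(tens_id [:: ty x] (T a)) -tensA -tens_compr //; by_ends.
by rewrite !ends /= e.
Qed.

(** A state is a list of distinct wires with an arrow into their tensor product;
    two states are the same when they differ by a reordering of the wires. *)
Definition same_state ws m ws' m' : Prop :=
  perm_eq ws ws' /\ sortm ws ∙ m = sortm ws' ∙ m'.

Lemma same_state_inj ws m m' : cod m = T ws -> cod m' = T ws ->
  same_state ws m ws m' -> m = m'.
Proof. by move=> e e' [_]; apply: iso_inj; rewrite ?ends //; exact: iso_sortm. Qed.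

Lemma same_state_sym ws m ws' m' : same_state ws m ws' m' -> same_state ws' m' ws m.
Proof. by case=> p e; split; rewrite // perm_sym. Qed.

Lemma same_state_trans ws m ws' m' ws'' m'' :
  same_state ws m ws' m' -> same_state ws' m' ws'' m'' -> same_state ws m ws'' m''.
Proof. by case=> p e [p' e']; split; [exact: perm_trans p p' | rewrite e]. Qed.

Lemma same_state_ex ws m ws' : cod m = T ws -> perm_eq ws ws' ->
  exists m', cod m' = T ws' /\ same_state ws m ws' m'.
Proof.
move=> cm p; have [b [db cb bK Kb]] := iso_sortm ws'.
have e : cod (sortm ws ∙ m) = dom b.
  by rewrite cod_comp ?ends ?db ?ends // (sortw_perm p).
exists (b ∙ (sortm ws ∙ m)); rewrite cod_comp // cb ends; split=> //.
split=> //; rewrite acompA // Kb comp1a // e db //.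
Qed.

(** A generator applied to the front wires commutes with the sorting of the
    wires behind them, so the result does not depend on their order. *)
Lemma same_state_step a b r r' g m m' : uniq r -> uniq r' ->
  dom g = T a -> cod g = T b -> cod m = T (a ++ r) -> cod m' = T (a ++ r') ->
  same_state (a ++ r) m (a ++ r') m' ->
  same_state (b ++ r) (g ⊠ idw r ∙ m) (b ++ r') (g ⊠ idw r' ∙ m').
Proof.
move=> ur ur' dg cg cm cm' [p e].
have pr : perm_eq r r' by rewrite perm_cat2l in p.
split; first by rewrite perm_cat2l.
have er := sortw_perm pr.
have sw s n : uniq s -> cod n = T (a ++ s) ->
    sortm (b ++ s) ∙ (g ⊠ idw s ∙ n)
    = sortm (b ++ sortw s) ∙ (g ⊠ idw (sortw s) ∙ (idw a ⊠ sortm s ∙ n)).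
  move=> us cn; rewrite sortm_cat // -acompA; try by_ends.
  congr (_ ∙ _); rewrite acompA; try by_ends.
  rewrite [RHS]acompA; try by_ends; congr (_ ∙ _).
  by have := interchange g (sortm s); rewrite !ends dg cg.
have pre s n : uniq s -> cod n = T (a ++ s) ->
    sortm (a ++ sortw s) ∙ (idw a ⊠ sortm s ∙ n) = sortm (a ++ s) ∙ n.
  move=> us cn; rewrite acompA; try by_ends.
  by rewrite -(sortm_cat a us).
have key : idw a ⊠ sortm r ∙ m = idw a ⊠ sortm r' ∙ m'.
  apply: (iso_inj (iso_sortm (a ++ sortw r'))).
  - by rewrite cod_comp -?er; by_ends.
  - by rewrite cod_comp; by_ends.
  - by rewrite -{1}er !pre.
by rewrite (sw r m) // (sw r' m') // key er.
Qed.

Definition sort_absorbs a b : Prop := forall p q,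
  sortm (p ++ a ++ b ++ q)
  = sortm (p ++ b ++ a ++ q) ∙ (idw p ⊠ symA (T a) (T b) ⊠ idw q).

Lemma sortm2 x y q : sortm [:: x, y & q]
  = ins x (insw y (sortw q)) ∙ idw [:: x] ⊠ ins y (sortw q) ∙ idw [:: x; y] ⊠ sortm q.
Proof.
rewrite -acompA; try by_ends.
rewrite -[idw [:: x; y]](tens_id [:: ty x] [:: ty y]) -tensA.
by rewrite -tens_compr //; by_ends.
Qed.

Lemma absorbs_swap x y : x != y -> sort_absorbs [:: x] [:: y].
Proof.
move=> ne p q; elim: p => [|z p IH]; last first.
  have e : sortw (p ++ [:: x, y & q]) = sortw (p ++ [:: y, x & q]).
    by apply: sortw_perm; rewrite perm_cat2l (perm_catCA [:: x] [:: y] q).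
  rewrite /= IH e tens_compr; try by_ends.
  rewrite acompA; try by_ends.
  by rewrite tensA tens_id.
rewrite tens1a [LHS]sortm2 [in RHS]sortm2 -(insK _ ne).
rewrite -[LHS]acompA; try by_ends.
rewrite -[RHS]acompA; try by_ends.
congr acomp.
by have := interchange (swap x y) (sortm q); rewrite !ends.
Qed.

Lemma absorbs_nil a : sort_absorbs a [::].
Proof. by move=> p q; rewrite sym_nil !tens_id compa1 //; by_ends. Qed.

Lemma absorbs_sym a b : sort_absorbs a b -> sort_absorbs b a.
Proof.
move=> ab p q; rewrite ab -acompA; try by_ends.
have := symAK (T b) (T a); set s := symA (T b) (T a); set s' := symA _ _ => sK.
have -> : (idw p ⊠ s' ⊠ idw q) ∙ (idw p ⊠ s ⊠ idw q) = idw (p ++ b ++ a ++ q).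
  rewrite -tens_compr // -tens_compl // sK !tens_id !map_cat -catA //.
by rewrite compa1 //; by_ends.
Qed.

Lemma absorbs_cons a y b :
  sort_absorbs a [:: y] -> sort_absorbs a b -> sort_absorbs a (y :: b).
Proof.
move=> ay ab p q.
have -> : symA (T a) (T (y :: b))
    = idw [:: y] ⊠ symA (T a) (T b) ∙ symA (T a) (T [:: y]) ⊠ idw b.
  exact: sym_hex [:: ty y] (T b).
rewrite (ay p (b ++ q)) /=.
have := ab (rcons p y) q; rewrite -!cats1 -!catA /= => ->.
rewrite -acompA; try by_ends; congr acomp.
rewrite [in RHS]tens_compl; try by_ends.
rewrite [in RHS]tens_compr; try by_ends.
by rewrite !map_cat -!tens_id -!tensA.
Qed.

Lemma absorbs_disjoint a b : ~~ has (mem a) b -> sort_absorbs a b.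
Proof.
have one x c : x \notin c -> sort_absorbs [:: x] c.
  elim: c => [|y c IH]; first by move=> _; apply: absorbs_nil.
  rewrite in_cons negb_or => /andP[ne xc].
  by apply: absorbs_cons; [exact: absorbs_swap | exact: IH].
elim: b => [|y b IH] /=; first by move=> _; apply: absorbs_nil.
rewrite negb_or => /andP[ya ab]; apply: absorbs_cons; last exact: IH.
by apply: absorbs_sym; exact: one.
Qed.

Lemma same_state_block p a b q m : uniq (a ++ b) -> cod m = T (p ++ a ++ b ++ q) ->
  same_state (p ++ a ++ b ++ q) m
             (p ++ b ++ a ++ q) (idw p ⊠ symA (T a) (T b) ⊠ idw q ∙ m).
Proof.
rewrite cat_uniq => /and3P[_ ab _] cm; split.
  by rewrite perm_cat2l perm_catCA.
by rewrite (absorbs_disjoint ab) acompA; try by_ends.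
Qed.

End Coherence.

(** * Programs on named wires *)

(** A generator with the names of its input wires and of its output wires. *)
Definition instr := (nat * seq nat * seq nat)%type.
Definition gen (i : instr) := i.1.1.
Definition inp (i : instr) := i.1.2.
Definition out (i : instr) := i.2.
Definition outs (P : seq instr) : seq nat := flatten (map out P).

(** Letters and generators are numbers, so that diagrams can be compared by
    computation. *)
Inductive diag :=
  | DId of seq nat
  | DGen of nat
  | DComp of diag & diag
  | DTens of diag & diag
  | DSym of seq nat & seq nat.

Section Programs.
Variables (C : ssmcat) (E : nat -> ob C) (col : nat -> nat).
Variables (G : nat -> arr C) (sig : nat -> seq nat * seq nat).
Hypothesis dom_G : forall k, dom (G k) = map E (sig k).1.
Hypothesis cod_G : forall k, cod (G k) = map E (sig k).2.
Local Notation ty := (fun w => E (col w)).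
Local Notation T := (map ty).
Local Notation idw ws := (idA (T ws)).
Local Notation "b ∙ a" := (acomp b a) (at level 40, left associativity).
Local Notation "a ⊠ b" := (atens a b) (at level 38, right associativity).
Local Notation same := (same_state ty).

Definition well_typed (i : instr) : bool :=
  (map col (inp i) == (sig (gen i)).1) && (map col (out i) == (sig (gen i)).2).

Ltac by_ends := solve_ends (ends ty).

Lemma well_typedP i : well_typed i ->
  dom (G (gen i)) = T (inp i) /\ cod (G (gen i)) = T (out i).
Proof. by case/andP=> /eqP e /eqP e'; rewrite dom_G cod_G -e -e' -!map_comp. Qed.

(** A relation rather than a function: an instruction acts on the front wires,
    after any reordering that brings its inputs there. *)
Fixpoint run (P : seq instr) ws m ws' m' : Prop :=
  if P is i :: P' then
    exists r m1, [/\ cod m1 = T (inp i ++ r), same ws m (inp i ++ r) m1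
      & run P' (out i ++ r) (G (gen i) ⊠ idw r ∙ m1) ws' m']
  else same ws m ws' m'.

Definition fresh (P : seq instr) (ws : seq nat) : bool := uniq (ws ++ outs P).

Lemma run_same P ws m ws1 m1 ws' m' :
  same ws m ws1 m1 -> run P ws1 m1 ws' m' -> run P ws m ws' m'.
Proof.
case: P => [|i P] s /=; first exact: same_state_trans s.
case=> r [m2 [c s' R]]; exists r, m2; split=> //; exact: same_state_trans s s'.
Qed.

Lemma run_trans P Q ws m ws1 m1 ws' m' :
  run P ws m ws1 m1 -> run Q ws1 m1 ws' m' -> run (P ++ Q) ws m ws' m'.
Proof.
elim: P ws m => [|i P IH] ws m /=; first exact: run_same.
by case=> r [m2 [c s R]] R'; exists r, m2; split=> //; exact: IH R R'.
Qed.

Lemma fresh_step i P ws r : fresh (i :: P) ws -> perm_eq ws (inp i ++ r) ->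
  [/\ fresh P (out i ++ r), uniq r & uniq ws].
Proof.
rewrite /fresh /outs /= => u p.
have {}u : uniq ((inp i ++ r) ++ out i ++ flatten (map out P)).
  by rewrite -(perm_uniq (perm_cat p (perm_refl _))).
have uw : uniq ws.
  by rewrite (perm_uniq p); move: u; rewrite cat_uniq => /andP[].
split=> //; last by move: uw; rewrite (perm_uniq p) cat_uniq => /and3P[].
move: u; rewrite -catA cat_uniq => /and3P[_ _].
by rewrite catA (perm_uniq (perm_cat (permEl (perm_catC r (out i))) (perm_refl _))).
Qed.

(** Coherence makes the reorderings in a run harmless: the final state is
    determined up to reordering. *)
Lemma run_det P ws m ws' m' w1 n1 w2 n2 : all well_typed P -> fresh P ws ->
  same ws m ws' m' -> run P ws m w1 n1 -> run P ws' m' w2 n2 -> same w1 n1 w2 n2.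
Proof.
elim: P ws m ws' m' => [|i P IH] ws m ws' m' /=.
  move=> _ _ s s1 s2.
  exact: same_state_trans (same_state_sym s1) (same_state_trans s s2).
case/andP=> /well_typedP[di ci] wP f s [r [m1 [c1 s1 R1]]] [r' [m1' [c1' s1' R1']]].
have [fP ur uw] := fresh_step f s1.1.
have ur' : uniq r'.
  by move: uw; rewrite (perm_uniq s.1) (perm_uniq s1'.1) cat_uniq => /and3P[].
apply: IH fP _ R1 R1' => //.
apply: (same_state_step ur ur' di ci c1 c1').
exact: same_state_trans (same_state_sym s1) (same_state_trans s s1').
Qed.

Lemma slide g g' q :
  symA (cod g) (cod g') ⊠ idw q ∙ g ⊠ g' ⊠ idw q
  = g' ⊠ g ⊠ idw q ∙ symA (dom g) (dom g') ⊠ idw q.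
Proof.
rewrite [in LHS]tensA [in RHS]tensA -[LHS]tens_compl // -[RHS]tens_compl //.
by rewrite sym_natural.
Qed.

Lemma same_block a b q m : uniq (a ++ b) -> cod m = T (a ++ b ++ q) ->
  same (a ++ b ++ q) m (b ++ a ++ q) (symA (T a) (T b) ⊠ idw q ∙ m).
Proof.
move=> u cm; have := @same_state_block _ ty [::] a b q m u cm.
by rewrite tens1a.
Qed.

Lemma uniq_blocks (a b q c d : seq nat) :
  uniq ((a ++ b ++ q) ++ c ++ d) -> uniq (d ++ a) /\ uniq (c ++ d).
Proof.
have sub s t : perm_eq ((a ++ b ++ q) ++ c ++ d) (s ++ t) ->
    uniq ((a ++ b ++ q) ++ c ++ d) -> uniq s.
  by move/perm_uniq=> ->; rewrite cat_uniq => /andP[].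
move=> u; split.
  by apply: (sub _ (b ++ q ++ c) _ u); apply/permP => x; rewrite !count_cat; lia.
by apply: (sub _ (a ++ b ++ q) _ u); apply/permP => x; rewrite !count_cat; lia.
Qed.

(** Two consecutive instructions can be exchanged when the second consumes no
    output of the first: this is the interchange law, conjugated by the block
    swaps that bring the inputs to the front. *)
Lemma run_commute i j P ws m ws' m' :
  well_typed i -> well_typed j -> fresh [:: i, j & P] ws ->
  ~~ has (mem (out i)) (inp j) ->
  run [:: i, j & P] ws m ws' m' -> run [:: j, i & P] ws m ws' m'.
Proof.
move=> /well_typedP[di ci] /well_typedP[dj cj] f dis.
set gi := G (gen i) in di ci *; set gj := G (gen j) in dj cj *.
case=> r1 [m1 [c1 s1]] [r2 [m2 [c2 s2 R]]].
have [f1 ur1 uw] := fresh_step f s1.1.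
have [f2 ur2 uw1] := fresh_step f1 s2.1.
(* q lists the wires that neither instruction touches. *)
pose q := [seq x <- r1 | x \notin inp j].
have pr1 : perm_eq r1 (inp j ++ q).
  have uj : uniq (inp j) by move: uw1; rewrite (perm_uniq s2.1) cat_uniq => /andP[].
  apply: uniq_perm => // [|x].
    rewrite cat_uniq uj filter_uniq // andbT.
    by apply/hasPn => x; rewrite mem_filter => /andP[].
  rewrite mem_cat mem_filter; case xj: (x \in inp j) => //=.
  have := perm_mem s2.1 x; rewrite !mem_cat xj /=.
  by have /negbTE := hasPn dis x xj; rewrite inE => -> /= ->.
have p1 : perm_eq ws (inp i ++ inp j ++ q).
  by rewrite (perm_trans s1.1) // perm_cat2l.
have uwij : uniq (inp i ++ inp j ++ q) by rewrite -(perm_uniq p1).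
have uq : uniq (inp j ++ q) by rewrite -(perm_uniq pr1).
have [n [cn sn]] := same_state_ex c1 (etrans (perm_cat2l (inp i) _ _) pr1).
have sn' := same_state_step ur1 uq di ci c1 cn sn.
have cgn : cod (gi ⊠ idw (inp j ++ q) ∙ n) = T (out i ++ inp j ++ q).
  by rewrite cod_comp ?cn /= ?ci ?di ?map_cat.
have uij' : uniq (out i ++ inp j).
  move: uw1; rewrite (perm_uniq (perm_cat (perm_refl (out i)) pr1)).
  by rewrite catA cat_uniq => /andP[].
have b1 := same_block uij' cgn.
have uij : uniq (inp i ++ inp j).
  by move: uwij; rewrite catA cat_uniq => /andP[].
(* n' and n3 are the states that arise when j runs first. *)
have b2 := same_block uij cn.
set n' := _ ∙ n in b2.
have cn' : cod n' = T (inp j ++ inp i ++ q).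
  by rewrite cod_comp ?cn /= ?map_cat // -catA.
have em : symA (T (out i)) (T (inp j)) ⊠ idw q ∙ (gi ⊠ idw (inp j ++ q) ∙ n)
    = idw (inp j) ⊠ gi ⊠ idw q ∙ n'.
  rewrite map_cat -tens_id [LHS]acompA ?cn /= ?ci ?di ?map_cat -?catA //.
  have := slide gi (idw (inp j)) q; rewrite /= ci di => ->.
  rewrite -[LHS]acompA; try by_ends.
  by [].
rewrite em in b1.
have cm'' : cod (idw (inp j) ⊠ gi ⊠ idw q ∙ n') = T (inp j ++ out i ++ q).
  by rewrite cod_comp ?cn' /= ?ci ?di !map_cat.
have uq2 : uniq (out i ++ q).
  move: uw1; rewrite (perm_uniq (perm_cat (perm_refl (out i)) pr1)).
  by rewrite (perm_uniq (permEl (perm_catCA _ _ _))) cat_uniq => /and3P[].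
have s3 := same_state_step ur2 uq2 dj cj c2 cm''
  (same_state_trans (same_state_sym s2) (same_state_trans sn' b1)).
have uf : uniq ((inp i ++ inp j ++ q) ++ out i ++ out j).
  move: f; rewrite /fresh (perm_uniq (perm_cat p1 (perm_refl _))) /outs /=.
  by rewrite !catA cat_uniq => /andP[].
have cn2 : cod (gj ⊠ idw (inp i ++ q) ∙ n') = T (out j ++ inp i ++ q).
  by rewrite cod_comp ?cn' /= ?cj ?dj !map_cat.
have [u_ji u_oo] := uniq_blocks uf.
have b3 := same_block u_ji cn2.
set n3 := symA _ _ ⊠ _ ∙ _ in b3.
have en3 : n3 = idw (inp i) ⊠ gj ⊠ idw q ∙ n.
  rewrite /n3 map_cat -tens_id [LHS]acompA; try by_ends.
  have := slide gj (idw (inp i)) q; rewrite /= cj dj => ->.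
  rewrite -[LHS]acompA; try by_ends.
  congr acomp; rewrite /n' acompA; try by_ends.
  by rewrite -tens_compl // symAK tens_id comp1a //; by_ends.
have cn3 : cod n3 = T (inp i ++ out j ++ q).
  by rewrite en3 cod_comp ?cn /= ?cj ?dj !map_cat.
have cn4 : cod (gi ⊠ idw (out j ++ q) ∙ n3) = T (out i ++ out j ++ q).
  by rewrite cod_comp ?cn3 /= ?ci ?di !map_cat.
have b4 := same_block u_oo cn4.
set n5 := symA _ _ ⊠ _ ∙ _ in b4.
have en5 : n5 = gj ⊠ idw (out i ++ q) ∙ (idw (inp j) ⊠ gi ⊠ idw q ∙ n').
  have -> : n5 = symA (T (out i)) (T (out j)) ⊠ idw q ∙ gi ⊠ gj ⊠ idw q ∙ n.
    rewrite /n5 en3 -[RHS]acompA; try by_ends.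
    congr acomp; rewrite [LHS]acompA; try by_ends.
    rewrite -tens_comp; try by_ends.
    by rewrite compa1 // comp1a //; by_ends.
  have := slide gi gj q; rewrite di dj ci cj => ->.
  rewrite -[LHS]acompA; try by_ends.
  rewrite [RHS]acompA; try by_ends.
  congr acomp; rewrite -tens_comp; try by_ends.
  by rewrite compa1 // comp1a //; by_ends.
rewrite en5 in b4.
exists (inp i ++ q), n'; split=> //.
  exact: same_state_trans s1 (same_state_trans sn b2).
exists (out j ++ q), n3; split=> //.
apply: run_same R; apply: same_state_trans b4 _; exact: same_state_sym s3.
Qed.

Lemma run_front P i Q ws m ws' m' :
  all well_typed (P ++ i :: Q) -> fresh (P ++ i :: Q) ws ->
  ~~ has (mem (outs P)) (inp i) ->
  run (P ++ i :: Q) ws m ws' m' -> run (i :: P ++ Q) ws m ws' m'.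
Proof.
elim: P ws m => [|j P IH] ws m //= /andP[wj w] f dis [r [m1 [c s R]]].
have [f' _ _] := fresh_step f s.1.
have ij : ~~ has (mem (out j)) (inp i).
  by apply: contra dis; apply: sub_has => x /= ; rewrite /outs /= mem_cat => ->.
have iP : ~~ has (mem (outs P)) (inp i).
  by apply: contra dis; apply: sub_has => x /= ; rewrite /outs /= mem_cat orbC => ->.
have R' := IH _ _ w f' iP R.
have wi : well_typed i by move: w; rewrite all_cat => /andP[_ /andP[]].
apply: run_commute => //; last by exists r, m1.
move: f; rewrite /fresh /outs /= !map_cat !flatten_cat /= => u.
rewrite -(perm_uniq (s1 := ws ++ out j ++ flatten (map out P)
  ++ out i ++ flatten (map out Q))) //.
by rewrite !perm_cat2l perm_catCA.
Qed.

(** An instruction may move to the front only past instructions whose outputs it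
    does not consume. *)
Fixpoint reorders (P Q : seq instr) : bool :=
  if Q is i :: Q' then
    [&& i \in P, ~~ has (mem (outs (take (index i P) P))) (inp i)
      & reorders (take (index i P) P ++ drop (index i P).+1 P) Q']
  else nilp P.

Lemma run_reorders P Q ws m ws' m' : reorders P Q ->
  all well_typed P -> fresh P ws -> run P ws m ws' m' -> run Q ws m ws' m'.
Proof.
elim: Q P ws m => [|i Q IH] P ws m /=; first by move/nilP=> ->.
case/and3P=> iP; set P1 := take _ P; set P2 := drop _ P => dis re w f R.
have eP : P = P1 ++ i :: P2.
  by rewrite -[LHS](cat_take_drop (index i P)) (drop_nth i) ?index_mem // nth_index.
rewrite eP in w f R.
have := run_front w f dis R => -[r [m1 [c s R']]].
exists r, m1; split=> //.
have f' : fresh (i :: P1 ++ P2) ws.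
  rewrite /fresh -(perm_uniq (s1 := ws ++ outs (P1 ++ i :: P2))) // perm_cat2l.
  rewrite /outs !map_cat /= map_cat.
  by rewrite !flatten_cat /= perm_catCA.
have [f2 _ _] := fresh_step f' s.1.
apply: IH R' => //.
by move: w; rewrite !all_cat /= => /and3P[-> _ ->].
Qed.

Fixpoint den (d : diag) : arr C :=
  match d with
  | DId s => idA (map E s)
  | DGen k => G k
  | DComp g f => acomp (den g) (den f)
  | DTens f g => atens (den f) (den g)
  | DSym s t => symA (map E s) (map E t)
  end.

Fixpoint ddom (d : diag) : seq nat :=
  match d with
  | DId s => s
  | DGen k => (sig k).1
  | DComp g f => ddom f
  | DTens f g => ddom f ++ ddom g
  | DSym s t => s ++ t
  end.

(** The outputs of the generators take their names from [ns].  For a tensor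
    product the wires of one factor wait while the other runs; the tests of
    [uniq] license the block swaps that this costs. *)
Fixpoint compile (d : diag) (xs ns : seq nat) :
    option (seq instr * seq nat * seq nat) :=
  match d with
  | DId s => if map col xs == s then Some ([::], xs, ns) else None
  | DGen k =>
      let n := size (sig k).2 in
      let i := (k, xs, take n ns) in
      if well_typed i then Some ([:: i], take n ns, drop n ns) else None
  | DComp g f =>
      if compile f xs ns is Some (P, ys, ns1) then
        if compile g ys ns1 is Some (Q, zs, ns2) then Some (P ++ Q, zs, ns2)
        else None
      else None
  | DTens f g =>
      let xs1 := take (size (ddom f)) xs in
      let xs2 := drop (size (ddom f)) xs in
      if compile f xs1 ns is Some (P, ys1, ns1) then
        if compile g xs2 ns1 is Some (Q, ys2, ns2) then
          if uniq (ys1 ++ xs2) && uniq (ys2 ++ ys1)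
          then Some (P ++ Q, ys1 ++ ys2, ns2) else None
        else None
      else None
  | DSym s t =>
      if (map col xs == s ++ t) && uniq xs
      then Some ([::], drop (size s) xs ++ take (size s) xs, ns) else None
  end.

Lemma run_end P ws m w1 m1 w2 m2 :
  run P ws m w1 m1 -> same w1 m1 w2 m2 -> run P ws m w2 m2.
Proof. by move=> R s; rewrite -(cats0 P); apply: run_trans R _. Qed.

Lemma same_refl ws m : same ws m ws m. Proof. by []. Qed.

Lemma map_ty ws : T ws = map E (map col ws).
Proof. by rewrite -map_comp. Qed.

(** The frame [r] stands for the wires beside the diagram. *)
Lemma compile_sound d xs ns P ys ns' : compile d xs ns = Some (P, ys, ns') ->
  [/\ dom (den d) = T xs, cod (den d) = T ys, all well_typed P
    & forall r m, cod m = T (xs ++ r) ->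
        run P (xs ++ r) m (ys ++ r) (den d ⊠ idw r ∙ m)].
Proof.
elim: d xs ns P ys ns' => [s|k|g IHg f IHf|f IHf g IHg|s t] xs ns P ys ns' /=.
- case: eqP => // <- [<- <- _]; rewrite map_ty; split=> // r m cm.
  by rewrite tens_id comp1a // cm map_cat map_ty.
- case: ifP => // w [<- <- _].
  have [di ci] := well_typedP w; rewrite /= w; split=> // r m cm.
  by exists r, m; split.
- case ef: (compile f xs ns) => [[[P1 y1] n1]|//].
  case eg: (compile g y1 n1) => [[[P2 y2] n2]|//] [<- <- _].
  have [df cf wf rf] := IHf _ _ _ _ _ ef; have [dg cg wg rg] := IHg _ _ _ _ _ eg.
  rewrite dom_comp cod_comp ?cf // all_cat wf wg; split=> // r m cm.
  rewrite tens_compl ?cf // -acompA; try by_ends.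
  by apply: run_trans (rf r m cm) (rg r _ _); by_ends.
- case ef: (compile f _ ns) => [[[P1 y1] n1]|//].
  case eg: (compile g _ n1) => [[[P2 y2] n2]|//].
  case: ifP => // /andP[u1 u2] [<- <- _].
  have [df cf wf rf] := IHf _ _ _ _ _ ef; have [dg cg wg rg] := IHg _ _ _ _ _ eg.
  rewrite all_cat wf wg; set xs1 := take _ _ in df rf; set xs2 := drop _ _ in dg rg u1.
  rewrite -[xs in T xs](cat_take_drop (size (ddom f))).
  split=> //; rewrite ?map_cat ?df ?dg ?cf ?cg // => r m.
  rewrite -[xs in xs ++ _](cat_take_drop (size (ddom f))) -!catA -/xs1 -/xs2 => cm.
  apply: run_trans (rf _ _ cm) _.
  set mf := _ ∙ m.
  have cmf : cod mf = T (y1 ++ xs2 ++ r) by by_ends.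
  apply: run_same (same_block u1 cmf) _; set ms := _ ∙ mf.
  have cms : cod ms = T (xs2 ++ y1 ++ r) by by_ends.
  apply: run_end (rg _ _ cms) _; set mg := _ ∙ ms.
  have cmg : cod mg = T (y2 ++ y1 ++ r) by by_ends.
  have := same_block u2 cmg.
  suff -> : symA (T y2) (T y1) ⊠ idw r ∙ mg = (den f ⊠ den g) ⊠ idw r ∙ m by [].
  rewrite /mg [in LHS]map_cat -tens_id [LHS]acompA; try by_ends.
  have := slide (den g) (idw y1) r; rewrite /= dg cg => ->.
  rewrite -[LHS]acompA; try by_ends.
  rewrite /ms [X in _ ∙ X]acompA; try by_ends.
  rewrite -tens_compl // symAK tens_id comp1a; try by_ends.
  rewrite /mf [in LHS]acompA; try by_ends.
  congr acomp; rewrite -tensA map_cat -tens_id -tens_comp; try by_ends.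
  by rewrite comp1a -?tens_comp ?compa1 ?comp1a //; by_ends.
- case: ifP => // /andP[/eqP exs uxs] [<- <- _].
  have e : xs = take (size s) xs ++ drop (size s) xs by rewrite cat_take_drop.
  have [e1 e2] : map col (take (size s) xs) = s /\ map col (drop (size s) xs) = t.
    by rewrite map_take map_drop exs take_size_cat // drop_size_cat.
  split=> //; rewrite ?map_ty ?map_cat ?exs ?e1 ?e2 ?map_cat // => r m.
  have -> : symA (map E s) (map E t)
      = symA (T (take (size s) xs)) (T (drop (size s) xs)).
    by rewrite !map_ty e1 e2.
  move: (take _ _) (drop _ _) e => a b e; rewrite {}e in uxs *.
  by rewrite -!catA => cm; apply: same_block.
Qed.

Theorem compile_eq d d' xs ns ns' P Q ys n1 n2 :
  compile d xs ns = Some (P, ys, n1) -> compile d' xs ns' = Some (Q, ys, n2) ->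
  reorders P Q -> fresh P xs -> fresh Q xs -> den d = den d'.
Proof.
move=> /compile_sound[dd cd wd rd] /compile_sound[dd' cd' wd' rd'] re u u'.
have cx : cod (idw xs) = T (xs ++ [::]) by rewrite cats0.
have := rd' _ _ cx; rewrite !cats0 !tensa1 compa1 // => R'.
have := rd _ _ cx; rewrite !cats0 !tensa1 compa1 // => R.
apply: (same_state_inj (ty := ty) (ws := ys)) => //.
exact: run_det wd' u' (same_refl _ _) (run_reorders re wd u R) R'.
Qed.

End Programs.

(** * Deciding the equality of diagrams *)

Section Solver.
Variable sig : nat -> seq nat * seq nat.

(** The letters of the named wires, in the order in which [compile] asks for
    names. *)
Fixpoint colors (d : diag) : seq nat :=
  match d with
  | DGen k => (sig k).2
  | DComp g f => colors f ++ colors g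
  | DTens f g => colors f ++ colors g
  | _ => [::]
  end.

(** The names for the second diagram are guessed from the program [P] of the
    first, by running it with instructions of [P].  An answer lists the output
    wires, the names that were used and the instructions that remain; several
    answers occur when generators without inputs are repeated. *)
Fixpoint replays (d : diag) (xs : seq nat) (P : seq instr) :
    seq (seq nat * seq nat * seq instr) :=
  match d with
  | DId s => [:: (xs, [::], P)]
  | DSym s t => [:: (drop (size s) xs ++ take (size s) xs, [::], P)]
  | DGen k =>
      [seq (out i, out i, rem i P) | i <- P & (gen i == k) && (inp i == xs)]
  | DComp g f =>
      flatten [seq [seq (b.1.1, a.1.2 ++ b.1.2, b.2) | b <- replays g a.1.1 a.2]
              | a <- replays f xs P]
  | DTens f g =>
      let n := size (ddom sig f) in
      flatten [seq [seq (a.1.1 ++ b.1.1, a.1.2 ++ b.1.2, b.2)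
                   | b <- replays g (drop n xs) a.2]
              | a <- replays f (take n xs) P]
  end.

Definition same_diagram (d d' : diag) : bool :=
  let cs := ddom sig d ++ colors d in
  let n := size (ddom sig d) in
  let col := nth 0 cs in
  let xs := iota 0 n in
  if compile col sig d xs (iota n (size cs - n)) is Some (P, ys, _) then
    has (fun a =>
      if compile col sig d' xs a.1.2 is Some (Q, ys', _) then
        [&& ys' == ys, reorders P Q, fresh P xs & fresh Q xs]
      else false) (replays d' xs P)
  else false.

Variables (C : ssmcat) (E : nat -> ob C) (G : nat -> arr C).
Hypothesis dom_G : forall k, dom (G k) = map E (sig k).1.
Hypothesis cod_G : forall k, cod (G k) = map E (sig k).2.

Theorem same_diagram_sound d d' : same_diagram d d' -> den E G d = den E G d'.
Proof.
rewrite /same_diagram; set col := nth _ _; set xs := iota _ _.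
case e: (compile _ _ d _ _) => [[[P ys] n1]|//] /hasP[[[z1 z2] z3] _].
case e': (compile _ _ d' _ _) => [[[Q ys'] n2]|//] /and4P[/eqP eys re u u'].
by rewrite {}eys in e'; exact: (compile_eq dom_G cod_G e e' re u u').
Qed.

End Solver.

(** * From morphisms to diagrams *)

Section Reification.
Variable C : ssmcat.

Record generator (E : nat -> ob C) := Generator {
  gsig : seq nat * seq nat;
  garr : whom (map E gsig.1) (map E gsig.2)
}.

Definition no_generator (E : nat -> ob C) : generator E :=
  @Generator E ([::], [::]) (wid [::]).

Definition interp (os : seq (ob C)) (gs : seq (generator (nth uob os))) :
    diag -> arr C :=
  den (nth uob os) (fun k => Arr (garr (nth (no_generator _) gs k))).

(** The list [sigs] repeats the endpoints of the generators, so that the test is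
    evaluated without touching the morphisms. *)
Lemma diagram_eq (os : seq (ob C)) (gs : seq (generator (nth uob os))) sigs d d' :
  map (@gsig _) gs = sigs ->
  same_diagram (fun k => nth ([::], [::]) sigs k) d d' ->
  interp gs d = interp gs d'.
Proof.
move=> e; apply: same_diagram_sound => k; rewrite -e.
  by elim: gs k {e} => [|g gs IH] [|k] //=; apply: IH.
by elim: gs k {e} => [|g gs IH] [|k] //=; apply: IH.
Qed.

Lemma Arr_wcomp s t u (g : whom t u) (f : whom s t) (a b : arr C) :
  Arr g = a -> Arr f = b -> Arr (g ∘ f) = acomp a b.
Proof. by move=> <- <-; apply: compE. Qed.

Lemma Arr_wtensor s t s' t' (f : whom s t) (g : whom s' t') (a b : arr C) :
  Arr f = a -> Arr g = b -> Arr (f ⊗ g) = atens a b.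
Proof. by move=> <- <-. Qed.

End Reification.

Ltac norm_word s := eval cbv beta iota delta [cat] in s.

Ltac mem_add x l :=
  lazymatch l with
  | nil => constr:(x :: nil)
  | x :: _ => l
  | ?y :: ?t => let t' := mem_add x t in constr:(y :: t')
  end.

Ltac index_of x l :=
  lazymatch l with
  | x :: _ => constr:(O)
  | _ :: ?t => let n := index_of x t in constr:(S n)
  end.

Ltac add_word s os :=
  lazymatch s with
  | nil => os
  | ?x :: ?t => let os' := mem_add x os in add_word t os'
  end.

Ltac reify_word os s :=
  lazymatch s with
  | nil => constr:(@nil nat)
  | ?x :: ?t => let n := index_of x os in let t' := reify_word os t in constr:(n :: t')
  end.

(** Endpoints are normalised, since generators are compared syntactically. *)
Ltac atom_arr f :=
  lazymatch type of f with
  | @whom ?C ?s ?t =>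
      let s' := norm_word s in let t' := norm_word t in constr:(@Arr C s' t' f)
  end.

(** In continuation-passing style, as it returns both the letters and the
    generators. *)
Ltac collect f os fs k :=
  lazymatch f with
  | @wcomp _ _ _ _ ?g ?h => collect g os fs ltac:(fun os fs => collect h os fs k)
  | @wtensor _ _ _ _ _ ?g ?h => collect g os fs ltac:(fun os fs => collect h os fs k)
  | @wid _ ?s => let s' := norm_word s in let os' := add_word s' os in k os' fs
  | @wsym _ ?s ?t =>
      let s' := norm_word s in let t' := norm_word t in
      let os' := add_word s' os in let os2 := add_word t' os' in k os2 fs
  | _ =>
      let a := atom_arr f in
      lazymatch a with
      | @Arr _ ?s ?t _ =>
          let os' := add_word s os in let os2 := add_word t os' in
          let fs' := mem_add a fs in k os2 fs'
      end
  end.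

Ltac reify os fs f :=
  lazymatch f with
  | @wcomp _ _ _ _ ?g ?h =>
      let dg := reify os fs g in let dh := reify os fs h in constr:(DComp dg dh)
  | @wtensor _ _ _ _ _ ?g ?h =>
      let dg := reify os fs g in let dh := reify os fs h in constr:(DTens dg dh)
  | @wid _ ?s => let s' := norm_word s in let w := reify_word os s' in constr:(DId w)
  | @wsym _ ?s ?t =>
      let s' := norm_word s in let t' := norm_word t in
      let w := reify_word os s' in let w' := reify_word os t' in constr:(DSym w w')
  | _ => let a := atom_arr f in let n := index_of a fs in constr:(DGen n)
  end.

Ltac arr_proof f :=
  lazymatch f with
  | @wcomp ?C ?s ?t ?u ?g ?h =>
      let pg := arr_proof g in let ph := arr_proof h in
      constr:(@Arr_wcomp C s t u g h _ _ pg ph)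
  | @wtensor ?C ?s ?t ?s' ?t' ?g ?h =>
      let pg := arr_proof g in let ph := arr_proof h in
      constr:(@Arr_wtensor C s t s' t' g h _ _ pg ph)
  | @wid ?C ?s => constr:(@erefl (arr C) (idA s))
  | @wsym ?C ?s ?t => constr:(@erefl (arr C) (symA s t))
  | _ => let a := atom_arr f in constr:(@erefl _ a)
  end.

Ltac generators C os fs :=
  lazymatch fs with
  | nil => constr:(@nil (@generator C (nth uob os)))
  | @Arr _ ?s ?t ?f :: ?fs' =>
      let w := reify_word os s in let w' := reify_word os t in
      let gs := generators C os fs' in
      constr:(@Generator C (nth uob os) (w, w') f :: gs)
  end.

Ltac signatures os fs :=
  lazymatch fs with
  | nil => constr:(@nil (seq nat * seq nat))
  | @Arr _ ?s ?t ?f :: ?fs' =>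
      let w := reify_word os s in let w' := reify_word os t in
      let gs := signatures os fs' in constr:((w, w') :: gs)
  end.

(** Proves an equation that holds in every symmetric monoidal category when the
    morphisms that are not built by the structure are arbitrary. *)
Ltac diagram :=
  lazymatch goal with
  | |- @eq _ ?l ?r =>
    lazymatch type of l with
    | @whom ?C ?s ?t =>
      collect l (@nil (ob C)) (@nil (arr C)) ltac:(fun os fs =>
      collect r os fs ltac:(fun os fs =>
        let dl := reify os fs l in
        let dr := reify os fs r in
        let gs := generators C os fs in
        let sg := signatures os fs in
        let pl := arr_proof l in
        let pr := arr_proof r in
        exact (@Arr_inj C s t l r (etrans pl (etrans
          (@diagram_eq C os gs sg dl dr erefl
             (@erefl bool true
                <: same_diagram (fun k => nth ([::], [::]) sg k) dl dr = true))
          (esym pr))))))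
    end
  end.

(** Replaces one side of an equation by an isotopic diagram, in which the next
    law to apply is visible as a subterm. *)
Tactic Notation "redraw" constr(X) := transitivity X; [diagram |].
Tactic Notation "redraw" "back" constr(X) := transitivity X; [| diagram].

(** * Cocommutative weak Hopf algebras *)

Section CocommutativeCoalgebra.
Variables (C : ssmcat) (d : ob C) (D : coalgebra_on d).
Local Notation Δ := (comul_of D).
Local Notation J := (wid [:: d]).
Local Notation c := (wsym [:: d] [:: d]).

Lemma comul_shuffle : c ∘ Δ = Δ ->
  (J ⊗ c ⊗ J) ∘ (Δ ⊗ Δ) ∘ Δ = (Δ ⊗ Δ) ∘ Δ.
Proof.
move=> cocomm; redraw ((J ⊗ c ⊗ J) ∘ (J ⊗ J ⊗ Δ) ∘ ((Δ ⊗ J) ∘ Δ)).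
rewrite comul_assoc; redraw ((J ⊗ ((c ⊗ J) ∘ ((J ⊗ Δ) ∘ Δ))) ∘ Δ).
rewrite -comul_assoc; redraw ((J ⊗ (((c ∘ Δ) ⊗ J) ∘ Δ)) ∘ Δ).
rewrite cocomm comul_assoc; redraw ((J ⊗ J ⊗ Δ) ∘ ((J ⊗ Δ) ∘ Δ)).
rewrite -comul_assoc; diagram.
Qed.

End CocommutativeCoalgebra.

Section WeakHopf.
Variables (C : ssmcat) (H : weak_hopf C).
Hypothesis cocomm : cocommutative H.
Local Notation h := (wh_ob H).
Local Notation η := (unit_of (wh_alg H)).
Local Notation μ := (mul_of (wh_alg H)).
Local Notation ε := (counit_of (wh_coalg H)).
Local Notation δ := (comul_of (wh_coalg H)).
Local Notation λ := (wh_lambda H).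
Local Notation I := (wid [:: h]).
Local Notation c := (wsym [:: h] [:: h]).
Local Notation ΠL := (PiL (wh_alg H) (wh_coalg H)).
Local Notation ΠR := (PiR (wh_alg H) (wh_coalg H)).
Local Notation "f ∗ g" := (convolution δ μ f g) (at level 39, left associativity).

Lemma comul_mul : δ ∘ μ = (μ ⊗ μ) ∘ (I ⊗ c ⊗ I) ∘ (δ ⊗ δ).
Proof. by rewrite (wh_comul_mul (wh_axioms H)) /comul2; diagram. Qed.

(** In Sweedler notation both sides are 1_1 h ⊗ 1_2.  Since h = 1h, the left-hand
    side is 1'_1 h_1 ⊗ ε(1_1 1'_2 h_2) 1_2; here the two copies of δ(1) merge,
    and ε then acts as a counit. *)
Lemma comul_PiL : (I ⊗ ΠL) ∘ δ = (μ ⊗ I) ∘ (I ⊗ c) ∘ ((δ ∘ η) ⊗ I).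
Proof.
transitivity ((I ⊗ ΠL) ∘ δ ∘ (μ ∘ (η ⊗ I))); first by rewrite mul1l; diagram.
redraw ((I ⊗ ΠL) ∘ (δ ∘ μ) ∘ (η ⊗ I)); rewrite comul_mul /PiL.
redraw ((μ ⊗ (ε ∘ (μ ∘ (I ⊗ μ))) ⊗ I) ∘ (I ⊗ I ⊗ I ⊗ wsym [:: h] [:: h; h])
  ∘ (I ⊗ I ⊗ (δ ∘ η) ⊗ I ⊗ I) ∘ (I ⊗ c ⊗ I) ∘ ((δ ∘ η) ⊗ δ)).
rewrite -mul_assoc.
redraw ((μ ⊗ (ε ∘ μ) ⊗ I) ∘ (I ⊗ I ⊗ I ⊗ c) ∘ (I ⊗ wsym [:: h; h] [:: h] ⊗ I)
  ∘ (((I ⊗ (μ ∘ c) ⊗ I) ∘ ((δ ∘ η) ⊗ (δ ∘ η))) ⊗ δ)).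
rewrite -(wh_comul_unit_op (wh_axioms H)).
redraw ((((I ⊗ ε) ∘ ((μ ⊗ μ) ∘ (I ⊗ c ⊗ I) ∘ (δ ⊗ δ))) ⊗ I) ∘ (I ⊗ c) ∘ ((δ ∘ η) ⊗ I)).
rewrite -comul_mul.
redraw (((((I ⊗ ε) ∘ δ) ∘ μ) ⊗ I) ∘ (I ⊗ c) ∘ ((δ ∘ η) ⊗ I)).
by rewrite comul1r; diagram.
Qed.

Lemma comul_PiR : (ΠR ⊗ I) ∘ δ = (I ⊗ μ) ∘ (c ⊗ I) ∘ (I ⊗ (δ ∘ η)).
Proof.
transitivity ((ΠR ⊗ I) ∘ δ ∘ (μ ∘ (I ⊗ η))); first by rewrite mul1r; diagram.
redraw ((ΠR ⊗ I) ∘ (δ ∘ μ) ∘ (I ⊗ η)); rewrite comul_mul /PiR.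
redraw ((I ⊗ (ε ∘ (μ ∘ (μ ⊗ I))) ⊗ μ) ∘ (wsym [:: h; h] [:: h] ⊗ I ⊗ I ⊗ I)
  ∘ (I ⊗ I ⊗ (δ ∘ η) ⊗ I ⊗ I) ∘ (I ⊗ c ⊗ I) ∘ (δ ⊗ (δ ∘ η))).
rewrite mul_assoc.
redraw ((I ⊗ (ε ∘ μ) ⊗ μ) ∘ (c ⊗ I ⊗ I ⊗ I) ∘ (I ⊗ wsym [:: h] [:: h; h] ⊗ I)
  ∘ (δ ⊗ ((I ⊗ (μ ∘ c) ⊗ I) ∘ ((δ ∘ η) ⊗ (δ ∘ η))))).
rewrite -(wh_comul_unit_op (wh_axioms H)) comul_assoc.
redraw ((I ⊗ ((ε ⊗ I) ∘ ((μ ⊗ μ) ∘ (I ⊗ c ⊗ I) ∘ (δ ⊗ δ)))) ∘ (c ⊗ I) ∘ (I ⊗ (δ ∘ η))).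
rewrite -comul_mul.
redraw ((I ⊗ (((ε ⊗ I) ∘ δ) ∘ μ)) ∘ (c ⊗ I) ∘ (I ⊗ (δ ∘ η))).
by rewrite comul1l; diagram.
Qed.

(** Both sides are ε(1_1 h) 1_2 ⊗ 1_3, thanks to cocommutativity. *)
Lemma PiL_comul : δ ∘ ΠL = (ΠL ⊗ ΠL) ∘ δ.
Proof.
apply: esym; redraw ((ΠL ⊗ I) ∘ ((I ⊗ ΠL) ∘ δ)); rewrite comul_PiL /PiL.
redraw (((ε ∘ (μ ∘ (I ⊗ μ))) ⊗ I ⊗ I) ∘ (I ⊗ I ⊗ wsym [:: h; h] [:: h])
  ∘ (I ⊗ c ⊗ I ⊗ I) ∘ ((δ ∘ η) ⊗ (δ ∘ η) ⊗ I)).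
rewrite -mul_assoc.
redraw (((ε ∘ μ) ⊗ I ⊗ I) ∘ (wsym [:: h] [:: h; h] ⊗ I) ∘ (I ⊗ I ⊗ c)
  ∘ (((I ⊗ μ ⊗ I) ∘ (((c ∘ δ) ∘ η) ⊗ (δ ∘ η))) ⊗ I)).
rewrite cocomm -(wh_comul_unit (wh_axioms H)).
redraw (((ε ∘ μ) ⊗ I ⊗ I) ∘ (I ⊗ wsym [:: h; h] [:: h])
  ∘ (((((c ∘ δ) ⊗ I) ∘ δ) ∘ η) ⊗ I)).
by rewrite cocomm comul_assoc; diagram.
Qed.

Lemma PiR_comul : δ ∘ ΠR = (ΠR ⊗ ΠR) ∘ δ.
Proof.
apply: esym; redraw ((I ⊗ ΠR) ∘ ((ΠR ⊗ I) ∘ δ)); rewrite comul_PiR /PiR.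
redraw ((I ⊗ I ⊗ (ε ∘ (μ ∘ (μ ⊗ I)))) ∘ (wsym [:: h] [:: h; h] ⊗ I ⊗ I)
  ∘ (I ⊗ I ⊗ c ⊗ I) ∘ (I ⊗ (δ ∘ η) ⊗ (δ ∘ η))).
rewrite mul_assoc.
redraw ((I ⊗ I ⊗ (ε ∘ μ)) ∘ (I ⊗ wsym [:: h; h] [:: h]) ∘ (c ⊗ I ⊗ I)
  ∘ (I ⊗ ((I ⊗ μ ⊗ I) ∘ ((δ ∘ η) ⊗ ((c ∘ δ) ∘ η))))).
rewrite cocomm -(wh_comul_unit (wh_axioms H)) comul_assoc.
redraw ((I ⊗ I ⊗ (ε ∘ μ)) ∘ (wsym [:: h] [:: h; h] ⊗ I)
  ∘ (I ⊗ (((I ⊗ (c ∘ δ)) ∘ δ) ∘ η))).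
by rewrite cocomm -comul_assoc; diagram.
Qed.

(** In Sweedler notation hΠ(k) = h_1 ε(h_2 k): expand h = h1 on the right, split
    ε(h_2 1_2 k) by the law of the counit, and contract h 1. *)
Lemma mul_PiL : μ ∘ (I ⊗ ΠL) = (I ⊗ (ε ∘ μ)) ∘ (δ ⊗ I).
Proof.
transitivity ((I ⊗ (ε ∘ μ)) ∘ ((δ ∘ (μ ∘ (I ⊗ η))) ⊗ I)); last first.
  by rewrite mul1r; diagram.
redraw back ((I ⊗ (ε ∘ μ)) ∘ ((δ ∘ μ) ⊗ I) ∘ (I ⊗ η ⊗ I)); rewrite comul_mul.
redraw back ((μ ⊗ ((ε ∘ μ) ∘ (μ ⊗ I))) ∘ (I ⊗ c ⊗ I ⊗ I) ∘ (δ ⊗ (δ ∘ η) ⊗ I)).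
rewrite (wh_counit_mul (wh_axioms H)).
redraw back ((μ ⊗ (ε ∘ μ) ⊗ (ε ∘ μ)) ∘ (I ⊗ c ⊗ I ⊗ I ⊗ I)
  ∘ (δ ⊗ (((I ⊗ δ) ∘ δ) ∘ η) ⊗ I)); rewrite -comul_assoc.
redraw back (((I ⊗ ε) ∘ ((μ ⊗ μ) ∘ (I ⊗ c ⊗ I) ∘ (δ ⊗ δ)) ⊗ (ε ∘ μ))
  ∘ (I ⊗ (δ ∘ η) ⊗ I)); rewrite -comul_mul.
redraw back (((((I ⊗ ε) ∘ δ) ∘ μ) ⊗ (ε ∘ μ)) ∘ (I ⊗ (δ ∘ η) ⊗ I)).
by rewrite comul1r -[in RHS]cocomm /PiL; diagram.
Qed.

Lemma comul_PiL_l : δ ∘ ΠL = (μ ⊗ I) ∘ (I ⊗ c) ∘ ((δ ∘ η) ⊗ ΠL).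
Proof.
rewrite /PiL; redraw (((ε ∘ μ) ⊗ I ⊗ I) ∘ (I ⊗ wsym [:: h; h] [:: h])
  ∘ ((((I ⊗ δ) ∘ δ) ∘ η) ⊗ I)).
rewrite -comul_assoc (wh_comul_unit_op (wh_axioms H)); diagram.
Qed.

Lemma comul_PiL_r : δ ∘ ΠL = (I ⊗ μ) ∘ ((δ ∘ η) ⊗ ΠL).
Proof.
rewrite -[in LHS]cocomm.
redraw (c ∘ (δ ∘ ΠL)); rewrite comul_PiL_l.
redraw ((I ⊗ μ) ∘ (((c ∘ δ) ∘ η) ⊗ ΠL)); by rewrite cocomm.
Qed.

Local Notation conv2 f g :=
  ((μ ⊗ μ) ∘ (I ⊗ c ⊗ I) ∘ (f ⊗ g) ∘ δ : [:: h] ~> [:: h; h]).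

(** Convolution of maps from H to H ⊗ H will identify δλ and (λ ⊗ λ)δ as inverses
    of δ. *)
Lemma conv2_assoc (f g k : [:: h] ~> [:: h; h]) :
  conv2 f (conv2 g k) = conv2 (conv2 f g) k.
Proof.
redraw (((μ ∘ (I ⊗ μ)) ⊗ (μ ∘ (I ⊗ μ))) ∘ (I ⊗ I ⊗ c ⊗ I ⊗ I)
  ∘ (I ⊗ c ⊗ c ⊗ I) ∘ (f ⊗ g ⊗ k) ∘ ((I ⊗ δ) ∘ δ)).
rewrite -mul_assoc -comul_assoc; diagram.
Qed.

Lemma conv2_comul (x y : [:: h] ~> [:: h]) :
  conv2 (δ ∘ x) (δ ∘ y) = δ ∘ (x ∗ y).
Proof.
redraw ((μ ⊗ μ) ∘ (I ⊗ c ⊗ I) ∘ (δ ⊗ δ) ∘ (x ⊗ y) ∘ δ).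
by rewrite -comul_mul /convolution; diagram.
Qed.

Lemma conv2_tensor (x y x' y' : [:: h] ~> [:: h]) :
  conv2 ((x ⊗ y) ∘ δ) ((x' ⊗ y') ∘ δ) = ((x ∗ x') ⊗ (y ∗ y')) ∘ δ.
Proof.
redraw ((μ ⊗ μ) ∘ (x ⊗ x' ⊗ y ⊗ y') ∘ ((I ⊗ c ⊗ I) ∘ (δ ⊗ δ) ∘ δ)).
by rewrite (comul_shuffle cocomm) /convolution; diagram.
Qed.

(** Both sides g satisfy g ∗ δ ∗ g = g, and they have the same products with δ on
    either side, because Π^L and Π^R are comultiplicative.  Such a generalized
    inverse is unique. *)
Lemma antipode_comul : δ ∘ λ = (λ ⊗ λ) ∘ δ.
Proof.
have lil : λ ∗ I ∗ λ = λ by exact: (wh_antipode (wh_axioms H)).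
have li : λ ∗ I = ΠR by exact: (wh_antipodeR (wh_axioms H)).
have il : I ∗ λ = ΠL by exact: (wh_antipodeL (wh_axioms H)).
have eδ : δ ∘ I = δ by diagram.
have eδ' : (I ⊗ I) ∘ δ = δ by diagram.
have := conv2_comul λ I; rewrite eδ li => cl.
have := conv2_comul I λ; rewrite eδ il => cr.
have := conv2_tensor λ λ I I; rewrite eδ' li => tl.
have := conv2_tensor I I λ λ; rewrite eδ' il => tr.
have g1 : conv2 (δ ∘ λ) δ = conv2 ((λ ⊗ λ) ∘ δ) δ by rewrite cl tl PiR_comul.
have g2 : conv2 δ (δ ∘ λ) = conv2 δ ((λ ⊗ λ) ∘ δ) by rewrite cr tr PiL_comul.
have k1 : conv2 (conv2 (δ ∘ λ) δ) (δ ∘ λ) = δ ∘ λ.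
  by rewrite cl conv2_comul -li lil.
have k2 : conv2 (conv2 ((λ ⊗ λ) ∘ δ) δ) ((λ ⊗ λ) ∘ δ) = (λ ⊗ λ) ∘ δ.
  by rewrite tl conv2_tensor -li lil.
by rewrite -[LHS]k1 g1 -conv2_assoc g2 conv2_assoc k2.
Qed.

End WeakHopf.

(** * Convolution over a cocommutative coalgebra *)

Record cocomm_coalgebra (C : ssmcat) : Type := CocommCoalgebra {
  cc_ob :> ob C;
  cc_str : coalgebra_on cc_ob;
  cc_cocomm : wsym [:: cc_ob] [:: cc_ob] ∘ comul_of cc_str = comul_of cc_str
}.

Section Calculus.
Variables (C : ssmcat) (H : weak_hopf C) (B : algebra C).
Variable φ : [:: wh_ob H; alg_ob B] ~> [:: alg_ob B].
Variable D : cocomm_coalgebra C.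
Local Notation h := (wh_ob H).
Local Notation b := (alg_ob B).
Local Notation d := (cc_ob D).
Local Notation δ := (comul_of (wh_coalg H)).
Local Notation μ := (mul_of (wh_alg H)).
Local Notation m := (amul B).
Local Notation Δ := (comul_of (cc_str D)).
Local Notation I := (wid [:: h]).
Local Notation J := (wid [:: d]).
Local Notation K := (wid [:: b]).

(** The Sweedler indices of a variable x in D disappear in the following calculus.
    Morphisms from D to B multiply by convolution; morphisms from D ⊗ B to B,
    read as functions of x and of a variable b, form a bimodule over them; a
    comultiplicative q from D to H acts on both through φ, multiplicatively. *)
Definition cmul : ([:: d] ~> [:: b]) -> ([:: d] ~> [:: b]) ->
    ([:: d] ~> [:: b]) :=
  convolution Δ m.
Definition qmul : ([:: d] ~> [:: h]) -> ([:: d] ~> [:: h]) ->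
    ([:: d] ~> [:: h]) :=
  convolution Δ μ.
Definition cone : [:: d] ~> [:: b] := aunit B ∘ counit_of (cc_str D).
Definition act (q : [:: d] ~> [:: h]) (f : [:: d] ~> [:: b]) : [:: d] ~> [:: b] :=
  φ ∘ (q ⊗ f) ∘ Δ.
Definition pair (s : [:: h; h] ~> [:: b]) (q r : [:: d] ~> [:: h]) : [:: d] ~> [:: b] :=
  s ∘ (q ⊗ r) ∘ Δ.

Definition lmul (f : [:: d] ~> [:: b]) (s : [:: d; b] ~> [:: b]) :
    [:: d; b] ~> [:: b] :=
  m ∘ (f ⊗ s) ∘ (Δ ⊗ K).
Definition rmul (s : [:: d; b] ~> [:: b]) (f : [:: d] ~> [:: b]) :
    [:: d; b] ~> [:: b] :=
  m ∘ (s ⊗ f) ∘ (J ⊗ wsym [:: d] [:: b]) ∘ (Δ ⊗ K).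
Definition Act (q : [:: d] ~> [:: h]) (s : [:: d; b] ~> [:: b]) : [:: d; b] ~> [:: b] :=
  φ ∘ (q ⊗ s) ∘ (Δ ⊗ K).
(** The function (x, b) ↦ b. *)
Definition var : [:: d; b] ~> [:: b] := counit_of (cc_str D) ⊗ K.

Definition comultiplicative (q : [:: d] ~> [:: h]) : Prop := δ ∘ q = (q ⊗ q) ∘ Δ.

Local Notation "f ⋆ g" := (cmul f g) (at level 39, left associativity).
Local Notation "f ◁ s" := (lmul f s) (at level 39, left associativity).
Local Notation "s ▷ f" := (rmul s f) (at level 39, left associativity).

Lemma mulA : m ∘ (m ⊗ K) = m ∘ (K ⊗ m).
Proof. exact: mul_assoc. Qed.

Lemma cmulA f g k : f ⋆ (g ⋆ k) = f ⋆ g ⋆ k.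
Proof.
rewrite /cmul /convolution; redraw (m ∘ (K ⊗ m) ∘ (f ⊗ g ⊗ k) ∘ ((J ⊗ Δ) ∘ Δ)).
rewrite -mulA -comul_assoc; diagram.
Qed.

Lemma cmul1r f : f ⋆ cone = f.
Proof.
rewrite /cmul /convolution /cone.
redraw (m ∘ (K ⊗ aunit B) ∘ f ∘ ((J ⊗ counit_of (cc_str D)) ∘ Δ)).
by rewrite comul1r mul1r; diagram.
Qed.

Lemma lmul_cmul f g s : (f ⋆ g) ◁ s = f ◁ (g ◁ s).
Proof.
rewrite /lmul /cmul /convolution.
redraw (m ∘ (m ⊗ K) ∘ (f ⊗ g ⊗ s) ∘ (((Δ ⊗ J) ∘ Δ) ⊗ K)).
rewrite mulA comul_assoc; diagram.
Qed.

Lemma rmul_cmul s f g : s ▷ (f ⋆ g) = s ▷ f ▷ g.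
Proof.
rewrite /rmul /cmul /convolution.
redraw (m ∘ (K ⊗ m) ∘ (s ⊗ f ⊗ g) ∘ (J ⊗ wsym [:: d; d] [:: b]) ∘ (((J ⊗ Δ) ∘ Δ) ⊗ K)).
rewrite -mulA -comul_assoc; diagram.
Qed.

Lemma lmul_rmul f s g : f ◁ (s ▷ g) = (f ◁ s) ▷ g.
Proof.
rewrite /rmul /lmul.
redraw (m ∘ (K ⊗ m) ∘ (f ⊗ s ⊗ g) ∘ (J ⊗ J ⊗ wsym [:: d] [:: b]) ∘ (((J ⊗ Δ) ∘ Δ) ⊗ K)).
rewrite -mulA -comul_assoc; diagram.
Qed.

Lemma lmul1 s : cone ◁ s = s.
Proof.
rewrite /lmul /cone.
redraw (m ∘ (aunit B ⊗ K) ∘ s ∘ (((counit_of (cc_str D) ⊗ J) ∘ Δ) ⊗ K)).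
by rewrite comul1l mul1l; diagram.
Qed.

Lemma rmul1 s : s ▷ cone = s.
Proof.
rewrite /rmul /cone.
redraw (m ∘ (K ⊗ aunit B) ∘ s ∘ (((J ⊗ counit_of (cc_str D)) ∘ Δ) ⊗ K)).
by rewrite comul1r mul1r; diagram.
Qed.

Lemma shuffle : (J ⊗ wsym [:: d] [:: d] ⊗ J) ∘ (Δ ⊗ Δ) ∘ Δ = (Δ ⊗ Δ) ∘ Δ.
Proof. exact: (comul_shuffle (cc_cocomm D)). Qed.

(** Used to move the argument of an action behind the copies that evaluate a
    morphism on H ⊗ H. *)
Lemma comul3_swap : (J ⊗ wsym [:: d] [:: d]) ∘ ((Δ ⊗ J) ∘ Δ) = (Δ ⊗ J) ∘ Δ.
Proof.
rewrite comul_assoc; redraw ((J ⊗ (wsym [:: d] [:: d] ∘ Δ)) ∘ Δ).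
by rewrite cc_cocomm.
Qed.

Lemma qmul_comult q r : comultiplicative q -> comultiplicative r ->
  comultiplicative (qmul q r).
Proof.
rewrite /comultiplicative /qmul /convolution => hq hr.
redraw ((δ ∘ μ) ∘ (q ⊗ r) ∘ Δ); rewrite comul_mul.
redraw ((μ ⊗ μ) ∘ (I ⊗ wsym [:: h] [:: h] ⊗ I) ∘ ((δ ∘ q) ⊗ (δ ∘ r)) ∘ Δ).
rewrite hq hr.
redraw ((μ ⊗ μ) ∘ (q ⊗ r ⊗ q ⊗ r) ∘ ((J ⊗ wsym [:: d] [:: d] ⊗ J) ∘ (Δ ⊗ Δ) ∘ Δ)).
rewrite shuffle; diagram.
Qed.

Lemma qmulA q r s : qmul q (qmul r s) = qmul (qmul q r) s.
Proof.
rewrite /qmul /convolution; redraw (μ ∘ (I ⊗ μ) ∘ (q ⊗ r ⊗ s) ∘ ((J ⊗ Δ) ∘ Δ)).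
rewrite -mul_assoc -comul_assoc; diagram.
Qed.

(** The middle two of four copies of x are exchanged, which cocommutativity
    allows. *)
Lemma pair_cmul s t q r : comultiplicative q -> comultiplicative r ->
  pair (convolution (comul2 (wh_coalg H)) m s t) q r = pair s q r ⋆ pair t q r.
Proof.
rewrite /comultiplicative /pair /cmul /convolution /comul2 => hq hr.
redraw (m ∘ (s ⊗ t) ∘ (I ⊗ wsym [:: h] [:: h] ⊗ I) ∘ ((δ ∘ q) ⊗ (δ ∘ r)) ∘ Δ).
rewrite hq hr.
redraw (m ∘ (s ⊗ t) ∘ (q ⊗ r ⊗ q ⊗ r) ∘ ((J ⊗ wsym [:: d] [:: d] ⊗ J) ∘ (Δ ⊗ Δ) ∘ Δ)).
rewrite shuffle; diagram.
Qed.

Section Measuring.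
Hypothesis weakB : weak_module_algebra φ.

Lemma measure : φ ∘ (I ⊗ m) = m ∘ (φ ⊗ φ) ∘ (I ⊗ wsym [:: h] [:: b] ⊗ K) ∘ (δ ⊗ K ⊗ K).
Proof. by case: weakB. Qed.

Lemma act_cmul q f g : comultiplicative q -> act q (f ⋆ g) = act q f ⋆ act q g.
Proof.
rewrite /comultiplicative /act /cmul /convolution => hq.
redraw (φ ∘ (I ⊗ m) ∘ (q ⊗ f ⊗ g) ∘ ((J ⊗ Δ) ∘ Δ)); rewrite measure.
redraw (m ∘ (φ ⊗ φ) ∘ (I ⊗ wsym [:: h] [:: b] ⊗ K) ∘ ((δ ∘ q) ⊗ f ⊗ g) ∘ ((J ⊗ Δ) ∘ Δ)).
rewrite hq.
redraw (m ∘ (φ ⊗ φ) ∘ (q ⊗ f ⊗ q ⊗ g) ∘ ((J ⊗ wsym [:: d] [:: d] ⊗ J) ∘ (Δ ⊗ Δ) ∘ Δ)).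
rewrite shuffle; diagram.
Qed.

Lemma Act_lmul q f s : comultiplicative q -> Act q (f ◁ s) = act q f ◁ Act q s.
Proof.
rewrite /comultiplicative /act /Act /lmul => hq.
redraw (φ ∘ (I ⊗ m) ∘ (q ⊗ f ⊗ s) ∘ (((J ⊗ Δ) ∘ Δ) ⊗ K)); rewrite measure.
redraw (m ∘ (φ ⊗ φ) ∘ (I ⊗ wsym [:: h] [:: b] ⊗ K) ∘ ((δ ∘ q) ⊗ f ⊗ s)
  ∘ (((J ⊗ Δ) ∘ Δ) ⊗ K)).
rewrite hq.
redraw (m ∘ (φ ⊗ φ) ∘ (q ⊗ f ⊗ q ⊗ s)
  ∘ (((J ⊗ wsym [:: d] [:: d] ⊗ J) ∘ (Δ ⊗ Δ) ∘ Δ) ⊗ K)).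
rewrite shuffle; diagram.
Qed.

Lemma Act_rmul q f s : comultiplicative q -> Act q (s ▷ f) = Act q s ▷ act q f.
Proof.
rewrite /comultiplicative /act /Act /rmul => hq.
redraw (φ ∘ (I ⊗ m) ∘ (q ⊗ s ⊗ f) ∘ (J ⊗ J ⊗ wsym [:: d] [:: b])
  ∘ (((J ⊗ Δ) ∘ Δ) ⊗ K)); rewrite measure.
redraw (m ∘ (φ ⊗ φ) ∘ (I ⊗ wsym [:: h] [:: b] ⊗ K) ∘ ((δ ∘ q) ⊗ s ⊗ f)
  ∘ (J ⊗ J ⊗ wsym [:: d] [:: b]) ∘ (((J ⊗ Δ) ∘ Δ) ⊗ K)).
rewrite hq.
redraw (m ∘ (φ ⊗ φ) ∘ (q ⊗ s ⊗ q ⊗ f) ∘ (J ⊗ J ⊗ wsym [:: d; d] [:: b])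
  ∘ (((J ⊗ wsym [:: d] [:: d] ⊗ J) ∘ (Δ ⊗ Δ) ∘ Δ) ⊗ K)).
rewrite shuffle; diagram.
Qed.

Lemma act_one q : act q cone = u1 φ ∘ q.
Proof.
rewrite /act /cone; redraw (φ ∘ (I ⊗ aunit B) ∘ q ∘ ((J ⊗ counit_of (cc_str D)) ∘ Δ)).
by rewrite comul1r; rewrite /u1; diagram.
Qed.

(** Weak associativity of the action on the unit, at the points q and r. *)
Lemma u_qmul q r : u1 φ ∘ qmul q r = act q (u1 φ ∘ r).
Proof.
case: weakB => _ _ e; rewrite /qmul /convolution.
redraw ((u1 φ ∘ μ) ∘ (q ⊗ r) ∘ Δ); rewrite e /act; diagram.
Qed.

Lemma act_u q f : comultiplicative q -> act q f ⋆ (u1 φ ∘ q) = act q f.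
Proof. by move=> hq; rewrite -act_one -act_cmul // cmul1r. Qed.

Lemma u_Act q s : comultiplicative q -> (u1 φ ∘ q) ◁ Act q s = Act q s.
Proof. by move=> hq; rewrite -act_one -Act_lmul // lmul1. Qed.

Lemma Act_u q s : comultiplicative q -> Act q s ▷ (u1 φ ∘ q) = Act q s.
Proof. by move=> hq; rewrite -act_one -Act_rmul // rmul1. Qed.

End Measuring.

Section Twisted.
Variables (s : [:: h; h] ~> [:: b]) (q r : [:: d] ~> [:: h]) (t : [:: d; b] ~> [:: b]).
Hypotheses (hq : comultiplicative q) (hr : comultiplicative r).
Local Notation X := ((q ⊗ r ⊗ t) ∘ (((Δ ⊗ J) ∘ Δ) ⊗ K)).

Lemma shuffle_pair : (q ⊗ r ⊗ q ⊗ r) ∘ ((Δ ⊗ Δ) ∘ Δ)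
  = (I ⊗ wsym [:: h] [:: h] ⊗ I) ∘ ((δ ∘ q) ⊗ (δ ∘ r)) ∘ Δ.
Proof. rewrite -shuffle hq hr; diagram. Qed.

(** Each side of the twisted condition, read at q, r and t: the copies of x are
    reshuffled into the order in which the condition distributes them. *)
Lemma twisted_lhs : Act q (Act r t) ▷ pair s q r
  = m ∘ (K ⊗ s) ∘ (P_phi φ ⊗ I) ∘ (I ⊗ P_phi φ) ∘ X.
Proof.
rewrite /Act /rmul /pair /P_phi.
redraw (m ∘ (φ ⊗ s) ∘ (I ⊗ φ ⊗ I ⊗ I) ∘ (q ⊗ r ⊗ t ⊗ q ⊗ r)
  ∘ (J ⊗ J ⊗ J ⊗ wsym [:: d; d] [:: b]) ∘ (((((J ⊗ Δ) ∘ Δ) ⊗ Δ) ∘ Δ) ⊗ K)).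
rewrite -comul_assoc.
redraw (m ∘ (φ ⊗ s) ∘ (I ⊗ φ ⊗ I ⊗ I) ∘ (q ⊗ r ⊗ t ⊗ q ⊗ r)
  ∘ (J ⊗ J ⊗ J ⊗ wsym [:: d; d] [:: b]) ∘ (Δ ⊗ J ⊗ Δ ⊗ K) ∘ (((Δ ⊗ J) ∘ Δ) ⊗ K)).
rewrite -[in LHS]comul3_swap.
redraw (m ∘ (φ ⊗ s) ∘ (I ⊗ φ ⊗ I ⊗ I) ∘ (I ⊗ I ⊗ wsym [:: h; h] [:: b])
  ∘ (((q ⊗ r ⊗ q ⊗ r) ∘ ((Δ ⊗ Δ) ∘ Δ)) ⊗ t) ∘ (Δ ⊗ K)).
rewrite shuffle_pair; diagram.
Qed.

Lemma twisted_rhs : pair s q r ◁ Act (qmul q r) t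
  = m ∘ (K ⊗ φ) ∘ (F_sigma s ⊗ K) ∘ X.
Proof.
rewrite /Act /lmul /pair /qmul /convolution /F_sigma /deltaHH /comul2.
redraw (m ∘ (K ⊗ φ) ∘ (s ⊗ μ ⊗ K) ∘ (q ⊗ r ⊗ q ⊗ r ⊗ t) ∘ (Δ ⊗ Δ ⊗ J ⊗ K)
  ∘ (((J ⊗ Δ) ∘ Δ) ⊗ K)).
rewrite -comul_assoc.
redraw (m ∘ (K ⊗ φ) ∘ (s ⊗ μ ⊗ K) ∘ (((q ⊗ r ⊗ q ⊗ r) ∘ ((Δ ⊗ Δ) ∘ Δ)) ⊗ t) ∘ (Δ ⊗ K)).
rewrite shuffle_pair; diagram.
Qed.

Lemma Act_twisted : twisted_condition φ s ->
  Act q (Act r t) ▷ pair s q r = pair s q r ◁ Act (qmul q r) t.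
Proof. by rewrite twisted_lhs twisted_rhs => ->. Qed.

End Twisted.

Definition commutes (f : [:: d] ~> [:: b]) : Prop :=
  m ∘ (f ⊗ K) = m ∘ wsym [:: b] [:: b] ∘ (f ⊗ K).

Lemma commutesP f : commutes f <-> f ◁ var = var ▷ f.
Proof.
have l : f ◁ var = m ∘ (f ⊗ K).
  rewrite /lmul /var.
  redraw (m ∘ (f ⊗ K) ∘ (((J ⊗ counit_of (cc_str D)) ∘ Δ) ⊗ K)).
  by rewrite comul1r; diagram.
have r : var ▷ f = m ∘ wsym [:: b] [:: b] ∘ (f ⊗ K).
  rewrite /rmul /var.
  redraw (m ∘ wsym [:: b] [:: b] ∘ (f ⊗ K)
    ∘ (((counit_of (cc_str D) ⊗ J) ∘ Δ) ⊗ K)).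
  by rewrite comul1l; diagram.
by rewrite l r.
Qed.

Lemma commutes_lmul f s : commutes f -> f ◁ s = s ▷ f.
Proof.
rewrite /commutes /lmul /rmul => e; redraw (m ∘ (f ⊗ K) ∘ (J ⊗ s) ∘ (Δ ⊗ K)); rewrite e.
rewrite -[in LHS]cc_cocomm; diagram.
Qed.

Lemma commutes_cmul f g : commutes f -> f ⋆ g = g ⋆ f.
Proof.
rewrite /commutes /cmul /convolution => e; redraw (m ∘ (f ⊗ K) ∘ (J ⊗ g) ∘ Δ); rewrite e.
rewrite -[in LHS]cc_cocomm; diagram.
Qed.

Lemma commutes_cmul2 f g : commutes f -> commutes g -> commutes (f ⋆ g).
Proof.
move=> cf cg; apply/commutesP.
by rewrite lmul_cmul (commutes_lmul _ cg) lmul_rmul (commutes_lmul _ cf) rmul_cmul.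
Qed.

End Calculus.

(** * Tensor products of cocommutative coalgebras *)

Section TensorCoalgebra.
Variables (C : ssmcat) (D D' : cocomm_coalgebra C).
Local Notation d := (cc_ob D).
Local Notation d' := (cc_ob D').
Local Notation Δ := (comul_of (cc_str D)).
Local Notation Δ' := (comul_of (cc_str D')).
Local Notation ε := (counit_of (cc_str D)).
Local Notation ε' := (counit_of (cc_str D')).
Local Notation J := (wid [:: d]).
Local Notation J' := (wid [:: d']).
Local Notation dd := (tob d d').

Definition pack : [:: d; d'] ~> [:: dd] := idm dd.
Definition unpack : [:: dd] ~> [:: d; d'] := idm dd.

Lemma packK : unpack ∘ pack = wid [:: d; d'].
Proof. exact: mcomp1m. Qed.

Lemma unpackK : pack ∘ unpack = wid [:: dd].
Proof. exact: mcomp1m. Qed.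

#[local] Opaque pack unpack.

(** [pack] and [unpack] are identities between a word of two letters and a single
    object: the calculus over D expects a single letter. *)
Definition tcounit : [:: dd] ~> [::] := (ε ⊗ ε') ∘ unpack.
Definition tcomul : [:: dd] ~> [:: dd; dd] :=
  (pack ⊗ pack) ∘ (J ⊗ wsym [:: d] [:: d'] ⊗ J') ∘ (Δ ⊗ Δ') ∘ unpack.

Lemma tcomul1l : (tcounit ⊗ wid [:: dd]) ∘ tcomul = wid [:: dd].
Proof.
rewrite /tcounit /tcomul.
redraw ((ε ⊗ ε' ⊗ wid [:: dd]) ∘ ((unpack ∘ pack) ⊗ pack)
  ∘ (J ⊗ wsym [:: d] [:: d'] ⊗ J') ∘ (Δ ⊗ Δ') ∘ unpack); rewrite packK.
redraw (pack ∘ (((ε ⊗ J) ∘ Δ) ⊗ ((ε' ⊗ J') ∘ Δ')) ∘ unpack).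
rewrite !comul1l; redraw (pack ∘ unpack); exact: unpackK.
Qed.

Lemma tcomul1r : (wid [:: dd] ⊗ tcounit) ∘ tcomul = wid [:: dd].
Proof.
rewrite /tcounit /tcomul.
redraw ((wid [:: dd] ⊗ ε ⊗ ε') ∘ (pack ⊗ (unpack ∘ pack))
  ∘ (J ⊗ wsym [:: d] [:: d'] ⊗ J') ∘ (Δ ⊗ Δ') ∘ unpack); rewrite packK.
redraw (pack ∘ (((J ⊗ ε) ∘ Δ) ⊗ ((J' ⊗ ε') ∘ Δ')) ∘ unpack).
rewrite !comul1r; redraw (pack ∘ unpack); exact: unpackK.
Qed.

Lemma tcomul_assoc :
  (tcomul ⊗ wid [:: dd]) ∘ tcomul = (wid [:: dd] ⊗ tcomul) ∘ tcomul.
Proof.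
rewrite /tcomul.
redraw ((((pack ⊗ pack) ∘ (J ⊗ wsym [:: d] [:: d'] ⊗ J') ∘ (Δ ⊗ Δ')
  ∘ (unpack ∘ pack)) ⊗ pack)
  ∘ (J ⊗ wsym [:: d] [:: d'] ⊗ J') ∘ (Δ ⊗ Δ') ∘ unpack).
redraw back ((pack ⊗ ((pack ⊗ pack) ∘ (J ⊗ wsym [:: d] [:: d'] ⊗ J')
  ∘ (Δ ⊗ Δ') ∘ (unpack ∘ pack)))
  ∘ (J ⊗ wsym [:: d] [:: d'] ⊗ J') ∘ (Δ ⊗ Δ') ∘ unpack).
rewrite packK.
redraw ((pack ⊗ pack ⊗ pack) ∘ (J ⊗ wsym [:: d] [:: d'] ⊗ wsym [:: d] [:: d'] ⊗ J')
  ∘ (J ⊗ J ⊗ wsym [:: d] [:: d'] ⊗ J' ⊗ J')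
  ∘ (((Δ ⊗ J) ∘ Δ) ⊗ ((Δ' ⊗ J') ∘ Δ')) ∘ unpack).
rewrite !comul_assoc; diagram.
Qed.

Lemma tcomul_cocomm : wsym [:: dd] [:: dd] ∘ tcomul = tcomul.
Proof.
rewrite /tcomul; redraw ((pack ⊗ pack) ∘ (J ⊗ wsym [:: d] [:: d'] ⊗ J')
  ∘ ((wsym [:: d] [:: d] ∘ Δ) ⊗ (wsym [:: d'] [:: d'] ∘ Δ')) ∘ unpack).
by rewrite !cc_cocomm.
Qed.

Definition tensor_coalgebra : cocomm_coalgebra C :=
  @CocommCoalgebra C dd (CoalgebraOn tcomul1l tcomul1r tcomul_assoc) tcomul_cocomm.

Definition tproj1 : [:: dd] ~> [:: d] := (J ⊗ ε') ∘ unpack.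
Definition tproj2 : [:: dd] ~> [:: d'] := (ε ⊗ J') ∘ unpack.

Lemma tproj_pair : (tproj1 ⊗ tproj2) ∘ tcomul = unpack.
Proof.
rewrite /tproj1 /tproj2 /tcomul.
redraw ((J ⊗ ε' ⊗ ε ⊗ J') ∘ ((unpack ∘ pack) ⊗ (unpack ∘ pack))
  ∘ (J ⊗ wsym [:: d] [:: d'] ⊗ J') ∘ (Δ ⊗ Δ') ∘ unpack); rewrite packK.
redraw ((((J ⊗ ε) ∘ Δ) ⊗ ((ε' ⊗ J') ∘ Δ')) ∘ unpack).
by rewrite comul1l comul1r; diagram.
Qed.

Lemma tproj1_comul : Δ ∘ tproj1 = (tproj1 ⊗ tproj1) ∘ tcomul.
Proof.
rewrite /tproj1 /tcomul; apply: esym.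
redraw ((J ⊗ ε' ⊗ J ⊗ ε') ∘ ((unpack ∘ pack) ⊗ (unpack ∘ pack))
  ∘ (J ⊗ wsym [:: d] [:: d'] ⊗ J') ∘ (Δ ⊗ Δ') ∘ unpack); rewrite packK.
redraw ((Δ ⊗ (ε' ∘ ((J' ⊗ ε') ∘ Δ'))) ∘ unpack).
by rewrite comul1r; diagram.
Qed.

Lemma tproj2_comul : Δ' ∘ tproj2 = (tproj2 ⊗ tproj2) ∘ tcomul.
Proof.
rewrite /tproj2 /tcomul; apply: esym.
redraw ((ε ⊗ J' ⊗ ε ⊗ J') ∘ ((unpack ∘ pack) ⊗ (unpack ∘ pack))
  ∘ (J ⊗ wsym [:: d] [:: d'] ⊗ J') ∘ (Δ ⊗ Δ') ∘ unpack); rewrite packK.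
redraw (((ε ∘ ((J ⊗ ε) ∘ Δ)) ⊗ Δ') ∘ unpack).
by rewrite comul1r; diagram.
Qed.

End TensorCoalgebra.

(** * The values of a weak action on the unit *)

Section UnitValues.
Variables (C : ssmcat) (H : weak_hopf C) (B : algebra C).
Hypothesis cocommH : cocommutative H.
Variable φ : [:: wh_ob H; alg_ob B] ~> [:: alg_ob B].
Hypothesis weakB : weak_module_algebra φ.
Local Notation h := (wh_ob H).
Local Notation b := (alg_ob B).
Local Notation η := (unit_of (wh_alg H)).
Local Notation μ := (mul_of (wh_alg H)).
Local Notation δ := (comul_of (wh_coalg H)).
Local Notation λ := (wh_lambda H).
Local Notation ΠL := (PiL (wh_alg H) (wh_coalg H)).
Local Notation m := (amul B).
Local Notation u := (u1 φ).
Local Notation I := (wid [:: h]).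
Local Notation K := (wid [:: b]).

Definition hopf_coalgebra : cocomm_coalgebra C :=
  @CocommCoalgebra C h (wh_coalg H) cocommH.

Lemma u_mul : u ∘ μ = φ ∘ (I ⊗ u). Proof. by case: weakB. Qed.
Lemma act_unit : φ ∘ (η ⊗ K) = K. Proof. by case: weakB. Qed.

(** Π(h)b = Π(h)(1b) = (1_1 Π(h) 1)(1_2 b) = 1((Π(h)1)b), writing the action as a
    juxtaposition: δΠ(h) is 1_1 Π(h) ⊗ 1_2, and the weak associativity of the
    action pulls 1_1 out. *)
Lemma act_PiL : φ ∘ (ΠL ⊗ K) = m ∘ ((u ∘ ΠL) ⊗ K).
Proof.
transitivity (φ ∘ (ΠL ⊗ (m ∘ (aunit B ⊗ K)))); first by rewrite mul1l; diagram.
redraw (φ ∘ (I ⊗ m) ∘ (ΠL ⊗ aunit B ⊗ K)); rewrite (measure weakB).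
redraw (m ∘ (φ ⊗ φ) ∘ (I ⊗ wsym [:: h] [:: b] ⊗ K) ∘ ((δ ∘ ΠL) ⊗ aunit B ⊗ K)).
rewrite comul_PiL_l; redraw (m ∘ ((φ ∘ (I ⊗ aunit B) ∘ μ) ⊗ φ)
  ∘ (I ⊗ wsym [:: h] [:: h] ⊗ K) ∘ ((δ ∘ η) ⊗ ΠL ⊗ K)).
rewrite -[φ ∘ (I ⊗ aunit B)]/u u_mul.
redraw (m ∘ (φ ⊗ φ) ∘ (I ⊗ wsym [:: h] [:: b] ⊗ K) ∘ (δ ⊗ K ⊗ K) ∘ (η ⊗ (u ∘ ΠL) ⊗ K)).
rewrite -(measure weakB); redraw (φ ∘ (η ⊗ K) ∘ m ∘ ((u ∘ ΠL) ⊗ K)).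
by rewrite act_unit; diagram.
Qed.

(** The mirror image, from b = b1 and δΠ(h) = 1_1 ⊗ 1_2 Π(h).  Together with
    [act_PiL] it makes the value of Π(h) on the unit central. *)
Lemma act_PiL_op : φ ∘ (ΠL ⊗ K) = m ∘ wsym [:: b] [:: b] ∘ ((u ∘ ΠL) ⊗ K).
Proof.
transitivity (φ ∘ (ΠL ⊗ (m ∘ (K ⊗ aunit B)))); first by rewrite mul1r; diagram.
redraw (φ ∘ (I ⊗ m) ∘ (ΠL ⊗ K ⊗ aunit B)); rewrite (measure weakB).
redraw (m ∘ (φ ⊗ φ) ∘ (I ⊗ wsym [:: h] [:: b] ⊗ K) ∘ ((δ ∘ ΠL) ⊗ K ⊗ aunit B)).
rewrite comul_PiL_r //; redraw (m ∘ (φ ⊗ (φ ∘ (I ⊗ aunit B) ∘ μ))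
  ∘ (I ⊗ wsym [:: h; h] [:: b]) ∘ ((δ ∘ η) ⊗ ΠL ⊗ K)).
rewrite -[φ ∘ (I ⊗ aunit B)]/u u_mul.
redraw (m ∘ (φ ⊗ φ) ∘ (I ⊗ wsym [:: h] [:: b] ⊗ K) ∘ (δ ⊗ K ⊗ K)
  ∘ (η ⊗ (wsym [:: b] [:: b] ∘ ((u ∘ ΠL) ⊗ K)))).
rewrite -(measure weakB); redraw (φ ∘ (η ⊗ K) ∘ m ∘ wsym [:: b] [:: b] ∘ ((u ∘ ΠL) ⊗ K)).
by rewrite act_unit; diagram.
Qed.

(** Write u(h) = 1_H (1_B u(h)) and use 1_1 ⊗ 1_2 h = Π(h_1) ⊗ h_2. *)
Lemma u_PiL_mul : u = m ∘ ((u ∘ ΠL) ⊗ u) ∘ δ.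
Proof.
transitivity (φ ∘ (η ⊗ K) ∘ (m ∘ (aunit B ⊗ K)) ∘ u).
  by rewrite act_unit mul1l; diagram.
redraw (φ ∘ (I ⊗ m) ∘ (η ⊗ aunit B ⊗ u)); rewrite (measure weakB).
redraw (m ∘ ((φ ∘ (I ⊗ aunit B)) ⊗ (φ ∘ (I ⊗ u))) ∘ ((δ ∘ η) ⊗ I)).
rewrite -[φ ∘ (I ⊗ aunit B)]/u -u_mul -[δ in LHS]cocommH.
redraw (m ∘ wsym [:: b] [:: b] ∘ (u ⊗ u)
  ∘ ((μ ⊗ I) ∘ (I ⊗ wsym [:: h] [:: h]) ∘ ((δ ∘ η) ⊗ I))).
rewrite -comul_PiL -[δ in RHS]cocommH; diagram.
Qed.

(** Since Π(h) = h_1 λ(h_2), the value u(Π(h)) = h_1 u(λ(h_2)) absorbs u(h) on the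
    right, whereas [u_PiL_mul] says that u(h) is u(Π(h_1)) u(h_2). *)
Lemma u_PiL : u ∘ ΠL = u.
Proof.
have comultI : comultiplicative (H := H) (D := hopf_coalgebra) I.
  by rewrite /comultiplicative /=; diagram.
have eL : u ∘ ΠL = act φ (D := hopf_coalgebra) I (u ∘ λ).
  by rewrite -(u_qmul (D := hopf_coalgebra) weakB) /qmul (wh_antipodeL (wh_axioms H)).
rewrite [RHS]u_PiL_mul -[RHS]/(cmul (B := B) (D := hopf_coalgebra) (u ∘ ΠL) u) eL.
have uI : u ∘ I = u by diagram.
by have := @act_u _ _ _ φ hopf_coalgebra weakB I (u ∘ λ) comultI; rewrite uI => ->.
Qed.

Lemma u_commutes (D : cocomm_coalgebra C) (q : [:: cc_ob D] ~> [:: h]) :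
  commutes (B := B) (u ∘ q).
Proof.
rewrite /commutes; redraw ((m ∘ (u ⊗ K)) ∘ (q ⊗ K)).
rewrite -{1}u_PiL -act_PiL act_PiL_op u_PiL; diagram.
Qed.

Lemma Act_PiL (D : cocomm_coalgebra C) (q : [:: cc_ob D] ~> [:: h]) s :
  Act φ (ΠL ∘ q) s = lmul (u ∘ q) s.
Proof.
rewrite /Act /lmul; redraw ((φ ∘ (ΠL ⊗ K)) ∘ (q ⊗ s) ∘ (comul_of (cc_str D) ⊗ K)).
rewrite act_PiL u_PiL; diagram.
Qed.

End UnitValues.

(** * Regular morphisms and quotients of twisted ones *)

Lemma reg_sym (C : ssmcat) (B : algebra C) w (delta : w ~> w ++ w)
    (u f g : w ~> [:: alg_ob B]) :
  regular_inverse delta u f g -> regular_inverse delta u g f.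
Proof. by case. Qed.

Section Regular.
Variables (C : ssmcat) (H : weak_hopf C) (B : algebra C).
Hypothesis cocommH : cocommutative H.
Variable φ : [:: wh_ob H; alg_ob B] ~> [:: alg_ob B].
Hypothesis weakB : weak_module_algebra φ.
Variable D : cocomm_coalgebra C.
Local Notation h := (wh_ob H).
Local Notation b := (alg_ob B).
Local Notation d := (cc_ob D).
Local Notation Δ := (comul_of (cc_str D)).
Local Notation μ := (mul_of (wh_alg H)).
Local Notation δ := (comul_of (wh_coalg H)).
Local Notation λ := (wh_lambda H).
Local Notation ε := (counit_of (wh_coalg H)).
Local Notation ΠL := (PiL (wh_alg H) (wh_coalg H)).
Local Notation u := (u1 φ).
Local Notation I := (wid [:: h]).
Local Notation J := (wid [:: d]).
Local Notation K := (wid [:: b]).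
Local Notation "f ⋆ g" := (cmul f g) (at level 39, left associativity).
Local Notation "f ◁ s" := (lmul f s) (at level 39, left associativity).
Local Notation "s ▷ f" := (rmul s f) (at level 39, left associativity).
Local Notation reg := (regular_inverse (B := B) Δ).
Local Notation reg2 := (regular_inverse (B := B) (deltaHH H) (u2 φ)).

(** Under the first two equations, the last two say that w is neutral for f
    and g. *)
Lemma regP w f g :
  reg w f g <-> [/\ f ⋆ g = w, g ⋆ f = w, w ⋆ f = f & w ⋆ g = g].
Proof.
rewrite /regular_inverse -!/(cmul _ _).
by split=> [[e1 e2]|[e1 e2]]; rewrite ?e1 ?e2.
Qed.

Lemma reg_idem w f g : reg w f g -> w ⋆ w = w.
Proof. by case/regP=> e1 _ e3 _; rewrite -{2 3}e1 cmulA e3. Qed.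

Lemma reg_unitr w f g : reg w f g -> f ⋆ w = f.
Proof. by case/regP=> e1 e2 e3 e4; rewrite -e2 cmulA e1. Qed.

Lemma reg_uniq w f g g' : reg w f g -> reg w f g' -> g = g'.
Proof.
case/regP=> e1 e2 e3 e4 r'; case/regP: (r') => e1' e2' e3' e4'.
by rewrite -e4 -e2' -cmulA e1 (reg_unitr (reg_sym r')).
Qed.

Lemma pair_reg s t (q r : [:: d] ~> [:: h]) :
  comultiplicative q -> comultiplicative r ->
  reg2 s t -> reg (u ∘ qmul q r) (pair s q r) (pair t q r).
Proof.
move=> hq hr.
have -> : u ∘ qmul q r = pair (u2 φ) q r.
  by rewrite /pair /u2 /qmul /convolution; diagram.
rewrite /deltaHH => -[e1 e2 e3 e4]; rewrite e1 in e3; rewrite e2 in e4.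
by apply/regP; rewrite -!pair_cmul // e1 e2 e3 e4.
Qed.

Lemma act_reg q r f g : comultiplicative q ->
  reg (u ∘ r) f g -> reg (u ∘ qmul q r) (act φ q f) (act φ q g).
Proof.
move=> hq /regP[e1 e2 e3 e4]; apply/regP.
by rewrite (u_qmul weakB) -!(act_cmul weakB) // e1 e2 e3 e4.
Qed.

Lemma PiL_comult (q : [:: d] ~> [:: h]) :
  comultiplicative q -> comultiplicative (ΠL ∘ q).
Proof.
rewrite /comultiplicative => hq; redraw ((δ ∘ ΠL) ∘ q); rewrite PiL_comul //.
redraw ((ΠL ⊗ ΠL) ∘ (δ ∘ q)); rewrite hq; diagram.
Qed.

Lemma antipode_comult (q : [:: d] ~> [:: h]) :
  comultiplicative q -> comultiplicative (λ ∘ q).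
Proof.
rewrite /comultiplicative => hq; redraw ((δ ∘ λ) ∘ q); rewrite antipode_comul //.
redraw ((λ ⊗ λ) ∘ (δ ∘ q)); rewrite hq; diagram.
Qed.

Lemma qmul_antipode (q : [:: d] ~> [:: h]) :
  comultiplicative q -> qmul q (λ ∘ q) = ΠL ∘ q.
Proof.
rewrite /comultiplicative /qmul /convolution => hq.
redraw (μ ∘ (I ⊗ λ) ∘ ((q ⊗ q) ∘ Δ)); rewrite -hq.
rewrite -(wh_antipodeL (wh_axioms H)) /convolution; diagram.
Qed.

Section Quotient.
Variables (σ τ α β : [:: h; h] ~> [:: b]).
Hypotheses (στ : reg2 σ τ) (αβ : reg2 α β).
Hypotheses (twσ : twisted_condition φ σ) (twα : twisted_condition φ α).

(** Write f for the quotient at q and r, and x for qr.  Conjugation by σ and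
    conjugation by α both turn the action of x into that of q after r, so f
    commutes with every value of the action of x ([fAct]).  It remains to reach
    b itself: conjugation by s0 = σ(x, λx) turns the action of x after λx into
    that of Π(x), which is multiplication by u(x).  Hence acting by λx and then
    by x on the conjugate v of b by the inverse of s0 gives u(x)b ([vE]), and f
    absorbs u(x). *)
Lemma quotient_commutes (q r : [:: d] ~> [:: h]) :
  comultiplicative q -> comultiplicative r ->
  commutes (pair τ q r ⋆ pair α q r).
Proof.
move=> hq hr; have hx := qmul_comult hq hr; set x := qmul q r in hx *.
have hy := antipode_comult hx; set y := λ ∘ x in hy *.
have /regP[st ts ws wt] := pair_reg hq hr στ.
have ra := pair_reg hq hr αβ; have /regP[_ _ wa _] := ra.
rewrite -/x in st ts ws wt wa ra.
set s := pair σ q r in st ts ws wt *; set t := pair τ q r in st ts ws wt *.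
set a := pair α q r in wa ra *; set f := t ⋆ a.
have eqa : a = s ⋆ f by rewrite /f cmulA st wa.
have fAct v : f ◁ Act φ x v = Act φ x v ▷ f.
  rewrite lmul_cmul -(Act_twisted _ hq hr twα) -/a {1}eqa rmul_cmul.
  rewrite (Act_twisted _ hq hr twσ).
  by rewrite lmul_rmul -/s -/x -lmul_cmul ts (u_Act weakB).
have rx := pair_reg hx hy στ.
have wE : u ∘ qmul x y = u ∘ x.
  rewrite qmul_antipode //.
  by redraw ((u ∘ ΠL) ∘ x); rewrite (u_PiL cocommH weakB).
rewrite {}wE in rx; have [/regP[st0 _ _ _] ww] := (rx, reg_idem rx).
set w := u ∘ x in st ts ws wt wa ra rx st0 ww.
set s0 := pair σ x y in rx st0; set t0 := pair τ x y in rx st0.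
have wc : commutes w by apply: (u_commutes cocommH weakB).
have wv : (w ◁ var B D) ▷ w = w ◁ var B D.
  by rewrite (commutes_lmul _ wc) -rmul_cmul ww.
pose v := t0 ◁ var B D ▷ s0.
have vE : Act φ x (Act φ y v) = w ◁ var B D.
  rewrite -(Act_u weakB) // -/w -st0 rmul_cmul (Act_twisted _ hx hy twσ).
  rewrite qmul_antipode // (Act_PiL cocommH weakB) -/s0 -/w.
  rewrite -lmul_cmul (reg_unitr rx) /v lmul_rmul -rmul_cmul.
  by rewrite -lmul_cmul st0 wv.
apply/commutesP; have := fAct (Act φ y v); rewrite vE -lmul_cmul.
have -> : f ⋆ w = f by rewrite /f -cmulA (reg_unitr ra).
by move=> ->; rewrite (commutes_lmul _ wc) -rmul_cmul /f cmulA wt.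
Qed.

End Quotient.

End Regular.

(** * The square and the cube of H *)

Section Cubes.
Variables (C : ssmcat) (H : weak_hopf C).
Hypothesis cocommH : cocommutative H.
Local Notation h := (wh_ob H).
Local Notation μ := (mul_of (wh_alg H)).
Local Notation δ := (comul_of (wh_coalg H)).
Local Notation I := (wid [:: h]).
Local Notation HC := (hopf_coalgebra cocommH).
Definition square : cocomm_coalgebra C := tensor_coalgebra HC HC.
Definition cube : cocomm_coalgebra C := tensor_coalgebra HC square.
Local Notation d2 := (cc_ob square).
Local Notation d3 := (cc_ob cube).
Local Notation Δ2 := (comul_of (cc_str square)).
Local Notation Δ3 := (comul_of (cc_str cube)).

Definition unpack2 : [:: d2] ~> [:: h; h] := unpack HC HC.
Definition pack2 : [:: h; h] ~> [:: d2] := pack HC HC.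
Definition split3 : [:: d3] ~> [:: h; d2] := unpack HC square.
Definition join3 : [:: h; d2] ~> [:: d3] := pack HC square.
Definition unpack3 : [:: d3] ~> [:: h; h; h] := (I ⊗ unpack2) ∘ split3.
Definition pack3 : [:: h; h; h] ~> [:: d3] := join3 ∘ (I ⊗ pack2).

Definition q1 : [:: d2] ~> [:: h] := tproj1 HC HC.
Definition q2 : [:: d2] ~> [:: h] := tproj2 HC HC.
Definition tail3 : [:: d3] ~> [:: d2] := tproj2 HC square.
Definition p1 : [:: d3] ~> [:: h] := tproj1 HC square.
Definition p2 : [:: d3] ~> [:: h] := q1 ∘ tail3.
Definition p3 : [:: d3] ~> [:: h] := q2 ∘ tail3.

Lemma pack2K : unpack2 ∘ pack2 = wid [:: h; h]. Proof. exact: (packK HC HC). Qed.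
Lemma join3K : split3 ∘ join3 = wid [:: h; d2]. Proof. exact: (packK HC square). Qed.

Lemma pack3K : unpack3 ∘ pack3 = wid [:: h; h; h].
Proof.
rewrite /unpack3 /pack3; redraw ((I ⊗ unpack2) ∘ (split3 ∘ join3) ∘ (I ⊗ pack2)).
by rewrite join3K; redraw (I ⊗ (unpack2 ∘ pack2)); rewrite pack2K; diagram.
Qed.

Lemma unpack2_inj A (f g : [:: h; h] ~> [:: A]) : f ∘ unpack2 = g ∘ unpack2 -> f = g.
Proof.
move=> e; redraw (f ∘ wid [:: h; h]); redraw back (g ∘ wid [:: h; h]).
by rewrite -pack2K; redraw (f ∘ unpack2 ∘ pack2); rewrite e; diagram.
Qed.

Lemma unpack3_inj A (f g : [:: h; h; h] ~> [:: A]) : f ∘ unpack3 = g ∘ unpack3 -> f = g.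
Proof.
move=> e; redraw (f ∘ wid [:: h; h; h]); redraw back (g ∘ wid [:: h; h; h]).
by rewrite -pack3K; redraw (f ∘ unpack3 ∘ pack3); rewrite e; diagram.
Qed.

Lemma q1_comult : comultiplicative (D := square) (H := H) q1.
Proof. exact: (tproj1_comul HC HC). Qed.
Lemma q2_comult : comultiplicative (D := square) (H := H) q2.
Proof. exact: (tproj2_comul HC HC). Qed.
Lemma p1_comult : comultiplicative (D := cube) (H := H) p1.
Proof. exact: (tproj1_comul HC square). Qed.

Lemma tail3_comult : Δ2 ∘ tail3 = (tail3 ⊗ tail3) ∘ Δ3.
Proof. exact: (tproj2_comul HC square). Qed.

Lemma comult_tail3 (q : [:: d2] ~> [:: h]) :
  comultiplicative (D := square) (H := H) q ->
  comultiplicative (D := cube) (H := H) (q ∘ tail3).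
Proof.
rewrite /comultiplicative => e; redraw ((δ ∘ q) ∘ tail3); rewrite e.
redraw ((q ⊗ q) ∘ (Δ2 ∘ tail3)); rewrite tail3_comult; diagram.
Qed.

Lemma p2_comult : comultiplicative (D := cube) (H := H) p2.
Proof. exact: comult_tail3 q1_comult. Qed.
Lemma p3_comult : comultiplicative (D := cube) (H := H) p3.
Proof. exact: comult_tail3 q2_comult. Qed.

Lemma unpack2E : (q1 ⊗ q2) ∘ Δ2 = unpack2.
Proof. exact: (tproj_pair HC HC). Qed.

Lemma split3E : (p1 ⊗ tail3) ∘ Δ3 = split3.
Proof. exact: (tproj_pair HC square). Qed.

(** The three projections of the cube, evaluated on copies of x, recover x. *)
Lemma unpack3E : (p1 ⊗ p2 ⊗ p3) ∘ ((wid [:: d3] ⊗ Δ3) ∘ Δ3) = unpack3.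
Proof.
rewrite /p2 /p3; redraw ((I ⊗ q1 ⊗ q2) ∘ (p1 ⊗ ((tail3 ⊗ tail3) ∘ Δ3)) ∘ Δ3).
rewrite -tail3_comult; redraw ((I ⊗ ((q1 ⊗ q2) ∘ Δ2)) ∘ ((p1 ⊗ tail3) ∘ Δ3)).
by rewrite unpack2E split3E.
Qed.

Lemma comul_square :
  Δ2 = (pack2 ⊗ pack2) ∘ (I ⊗ wsym [:: h] [:: h] ⊗ I) ∘ (δ ⊗ δ) ∘ unpack2.
Proof. by []. Qed.

Lemma comul_cube : Δ3 = (join3 ⊗ join3) ∘ (I ⊗ wsym [:: h] [:: d2] ⊗ wid [:: d2])
  ∘ (δ ⊗ Δ2) ∘ split3.
Proof. by []. Qed.

Lemma deltaHH_unpack : deltaHH H ∘ unpack2 = (unpack2 ⊗ unpack2) ∘ Δ2.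
Proof.
rewrite comul_square /deltaHH /comul2.
redraw back (((unpack2 ∘ pack2) ⊗ (unpack2 ∘ pack2))
  ∘ (I ⊗ wsym [:: h] [:: h] ⊗ I) ∘ (δ ⊗ δ) ∘ unpack2).
rewrite pack2K; diagram.
Qed.

Lemma deltaHHH_unpack : deltaHHH H ∘ unpack3 = (unpack3 ⊗ unpack3) ∘ Δ3.
Proof.
rewrite comul_cube /unpack3 /deltaHHH.
redraw back ((I ⊗ unpack2 ⊗ I ⊗ unpack2) ∘ ((split3 ∘ join3) ⊗ (split3 ∘ join3))
  ∘ (I ⊗ wsym [:: h] [:: d2] ⊗ wid [:: d2]) ∘ (δ ⊗ Δ2) ∘ split3).
rewrite join3K.
redraw ((I ⊗ wsym [:: h] [:: h; h] ⊗ wid [:: h; h])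
  ∘ (δ ⊗ (deltaHH H ∘ unpack2)) ∘ split3).
rewrite deltaHH_unpack; diagram.
Qed.

End Cubes.

(** * Cofaces and the cocycle condition *)

Section Cofaces.
Variables (C : ssmcat) (H : weak_hopf C) (B : algebra C).
Hypothesis cocommH : cocommutative H.
Variable φ : [:: wh_ob H; alg_ob B] ~> [:: alg_ob B].
Local Notation h := (wh_ob H).
Local Notation b := (alg_ob B).
Local Notation μ := (mul_of (wh_alg H)).
Local Notation δ := (comul_of (wh_coalg H)).
Local Notation ε := (counit_of (wh_coalg H)).
Local Notation ΠL := (PiL (wh_alg H) (wh_coalg H)).
Local Notation m := (amul B).
Local Notation u := (u1 φ).
Local Notation Sq := (square cocommH).
Local Notation Cu := (cube cocommH).
Local Notation d3 := (cc_ob Cu).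
Local Notation Δ3 := (comul_of (cc_str Cu)).
Local Notation I := (wid [:: h]).
Local Notation J := (wid [:: d3]).
Local Notation K := (wid [:: b]).
Local Notation p1 := (p1 cocommH).
Local Notation p2 := (p2 cocommH).
Local Notation p3 := (p3 cocommH).
Local Notation q1 := (q1 cocommH).
Local Notation q2 := (q2 cocommH).
Local Notation unpack2 := (unpack2 cocommH).
Local Notation unpack3 := (unpack3 cocommH).
Local Notation "f ⋆ g" := (cmul f g) (at level 39, left associativity).
Local Notation qm := (qmul (D := Cu)).

Lemma unpack3El : (p1 ⊗ p2 ⊗ p3) ∘ ((Δ3 ⊗ J) ∘ Δ3) = unpack3.
Proof. by rewrite comul_assoc unpack3E. Qed.

Lemma coface0E s : coface0 φ s ∘ unpack3 = act φ (D := Cu) p1 (pair s p2 p3).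
Proof. rewrite -unpack3E /coface0 /act /pair; diagram. Qed.

Lemma coface1E (s : [:: h; h] ~> [:: b]) :
  coface1 (B := B) s ∘ unpack3 = pair (D := Cu) s (qm p1 p2) p3.
Proof. rewrite -unpack3El /coface1 /qmul /convolution /pair; diagram. Qed.

Lemma coface2E (s : [:: h; h] ~> [:: b]) :
  coface2 (B := B) s ∘ unpack3 = pair (D := Cu) s p1 (qm p2 p3).
Proof. rewrite -unpack3E /coface2 /qmul /convolution /pair; diagram. Qed.

Lemma coface3E (s : [:: h; h] ~> [:: b]) :
  coface3 (B := B) s ∘ unpack3 = pair (D := Cu) s p1 (qm p2 (ΠL ∘ p3)).
Proof. rewrite -unpack3E /coface3 /qmul /convolution /pair; diagram. Qed.

Lemma u3E : u3 φ ∘ unpack3 = u ∘ qm p1 (qm p2 p3).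
Proof. rewrite qmulA -unpack3El /u3 /qmul /convolution; diagram. Qed.

Lemma conv3E f g : conv3 (B := B) f g ∘ unpack3
  = cmul (B := B) (D := Cu) (f ∘ unpack3) (g ∘ unpack3).
Proof.
rewrite /conv3 /cmul /convolution; redraw (m ∘ (f ⊗ g) ∘ (deltaHHH H ∘ unpack3)).
rewrite deltaHHH_unpack; diagram.
Qed.

Local Notation w3 := (u ∘ qm p1 (qm p2 p3)).
Local Notation reg3 := (regular_inverse (B := B) Δ3 w3).
Local Notation reg2 := (regular_inverse (B := B) (deltaHH H) (u2 φ)).

Lemma reg_unpack3 f g : regular_inverse (B := B) (deltaHHH H) (u3 φ) f g <->
  reg3 (f ∘ unpack3) (g ∘ unpack3).
Proof.
split=> [[e1 e2 e3 e4]|/regP[e1 e2 e3 e4]].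
  rewrite e1 in e3; rewrite e2 in e4.
  by apply/regP; rewrite -u3E -!conv3E /conv3 e1 e2 e3 e4.
rewrite /regular_inverse -!/(conv3 _ _).
rewrite -u3E -!conv3E in e1 e2 e3 e4.
rewrite (unpack3_inj e1) (unpack3_inj e2).
by split=> //; [exact: unpack3_inj e3 | exact: unpack3_inj e4].
Qed.

Lemma inv3E f g : regular_inverse (B := B) (deltaHHH H) (u3 φ) f g ->
  inv3 φ f = g.
Proof.
move=> r; apply: (unpack3_inj (cocommH := cocommH)).
have r' := epsilon_spec (inhabits (u3 φ)) _ (ex_intro _ g r).
move/reg_unpack3: r' => r'; move/reg_unpack3: r => r.
by have := reg_uniq r' r.
Qed.

Hypothesis weakB : weak_module_algebra φ.
Let hp1 := p1_comult cocommH.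
Let hp2 := p2_comult cocommH.
Let hp3 := p3_comult cocommH.

Lemma u_PiL3 : u ∘ qm p1 (qm p2 (ΠL ∘ p3)) = w3.
Proof.
rewrite !(u_qmul weakB); congr (act _ _ (act _ _ _)).
by redraw ((u ∘ ΠL) ∘ p3); rewrite (u_PiL cocommH weakB).
Qed.

Section RegularCofaces.
Variables s t : [:: h; h] ~> [:: b].
Hypothesis st : reg2 s t.

Lemma coface0_reg : reg3 (coface0 φ s ∘ unpack3) (coface0 φ t ∘ unpack3).
Proof. by rewrite !coface0E; apply: act_reg => //; apply: pair_reg. Qed.

Lemma coface1_reg : reg3 (coface1 (B := B) s ∘ unpack3) (coface1 (B := B) t ∘ unpack3).
Proof. by rewrite !coface1E qmulA; apply: pair_reg => //; apply: qmul_comult. Qed.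

Lemma coface2_reg : reg3 (coface2 (B := B) s ∘ unpack3) (coface2 (B := B) t ∘ unpack3).
Proof. by rewrite !coface2E; apply: pair_reg => //; apply: qmul_comult. Qed.

Lemma coface3_reg : reg3 (coface3 (B := B) s ∘ unpack3) (coface3 (B := B) t ∘ unpack3).
Proof.
rewrite !coface3E -u_PiL3; apply: pair_reg => //; apply: qmul_comult => //.
exact: PiL_comult.
Qed.

(** Since gΠ(k) = g_1 ε(g_2 k), replacing g by gΠ(k) multiplies s(x, g) by the
    scalar [e].  The unit u(xg) is multiplied by the same scalar, and becomes
    u(xgΠ(k)) = u(xgk). *)
Lemma coface3_restrict :
  coface3 (B := B) s ∘ unpack3 = pair (D := Cu) s p1 p2 ⋆ w3.
Proof.
pose e : [:: d3] ~> [::] := ε ∘ qm p2 p3.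
have scalar : qm p2 (ΠL ∘ p3) = (p2 ⊗ e) ∘ Δ3.
  rewrite /e /qmul /convolution; redraw ((μ ∘ (I ⊗ ΠL)) ∘ (p2 ⊗ p3) ∘ Δ3).
  rewrite mul_PiL; last exact: cocommH.
  redraw ((I ⊗ (ε ∘ μ)) ∘ ((δ ∘ p2) ⊗ p3) ∘ Δ3); rewrite hp2.
  redraw ((I ⊗ (ε ∘ μ)) ∘ (p2 ⊗ p2 ⊗ p3) ∘ ((Δ3 ⊗ J) ∘ Δ3)).
  rewrite comul_assoc; diagram.
rewrite -u_PiL3 coface3E scalar.
pose v := u ∘ qm p1 p2; have sv : pair s p1 p2 ⋆ v = pair s p1 p2.
  exact: reg_unitr (pair_reg hp1 hp2 st).
have -> : u ∘ qm p1 ((p2 ⊗ e) ∘ Δ3) = (v ⊗ e) ∘ Δ3.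
  rewrite /v /qmul /convolution; redraw (u ∘ μ ∘ (p1 ⊗ p2 ⊗ e) ∘ ((J ⊗ Δ3) ∘ Δ3)).
  rewrite -comul_assoc; diagram.
have -> : pair s p1 p2 ⋆ ((v ⊗ e) ∘ Δ3) = ((pair s p1 p2 ⋆ v) ⊗ e) ∘ Δ3.
  rewrite /cmul /convolution.
  redraw (m ∘ (pair s p1 p2 ⊗ v ⊗ e) ∘ ((J ⊗ Δ3) ∘ Δ3)).
  rewrite -comul_assoc; diagram.
rewrite sv /pair; redraw (s ∘ (p1 ⊗ p2 ⊗ e) ∘ ((J ⊗ Δ3) ∘ Δ3)).
rewrite -comul_assoc; diagram.
Qed.

Lemma cocycle_rhs :
  (m ∘ (K ⊗ s) ∘ (F_sigma s ⊗ I)) ∘ unpack3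
  = (coface3 (B := B) s ∘ unpack3) ⋆ (coface1 (B := B) s ∘ unpack3).
Proof.
have /regP[_ _ ws _] := coface1_reg.
rewrite coface3_restrict -cmulA ws coface1E -unpack3El /F_sigma /deltaHH /comul2.
redraw (m ∘ (s ⊗ s) ∘ (I ⊗ I ⊗ μ ⊗ I)
  ∘ (((I ⊗ wsym [:: h] [:: h] ⊗ I) ∘ ((δ ∘ p1) ⊗ (δ ∘ p2)) ∘ Δ3) ⊗ p3) ∘ Δ3).
rewrite -(shuffle_pair hp1 hp2) /cmul /pair /qmul /convolution.
redraw (m ∘ (s ⊗ s) ∘ (p1 ⊗ p2 ⊗ (μ ∘ (p1 ⊗ p2)) ⊗ p3)
  ∘ (Δ3 ⊗ Δ3 ⊗ J) ∘ ((Δ3 ⊗ J) ∘ Δ3)).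
rewrite comul_assoc; diagram.
Qed.

Lemma cocycle_lhs :
  m ∘ (K ⊗ s) ∘ (P_phi φ ⊗ I) ∘ (I ⊗ F_sigma s)
  = conv3 (coface0 φ s) (coface2 (B := B) s).
Proof.
rewrite /conv3 /convolution /coface0 /coface2 /F_sigma /P_phi.
rewrite /deltaHHH /deltaHH /comul2; diagram.
Qed.

(** In the group of regular morphisms on the cube the cocycle condition is
    ∂0 ∗ ∂2 = ∂3 ∗ ∂1: here ∂3 s may replace s(x, g), because the difference is
    the unit of ∂1 s. *)
Lemma cocycleP : cocycle_condition φ s <->
  (coface0 φ s ∘ unpack3) ⋆ (coface2 (B := B) s ∘ unpack3)
  = (coface3 (B := B) s ∘ unpack3) ⋆ (coface1 (B := B) s ∘ unpack3).
Proof.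
rewrite -cocycle_rhs -conv3E -cocycle_lhs; split=> [e|]; last exact: unpack3_inj.
by rewrite e.
Qed.

Lemma inv_coface1 : inv3 φ (coface1 (B := B) s) = coface1 (B := B) t.
Proof. by apply: inv3E; apply/reg_unpack3; exact: coface1_reg. Qed.

Lemma inv_coface3 : inv3 φ (coface3 (B := B) s) = coface3 (B := B) t.
Proof. by apply: inv3E; apply/reg_unpack3; exact: coface3_reg. Qed.

End RegularCofaces.

End Cofaces.

(** * Products of a twisted morphism with a central one *)

Section TwistedProduct.
Variables (C : ssmcat) (H : weak_hopf C) (B : algebra C).
Hypothesis cocommH : cocommutative H.
Variable φ : [:: wh_ob H; alg_ob B] ~> [:: alg_ob B].
Local Notation h := (wh_ob H).
Local Notation b := (alg_ob B).
Local Notation m := (amul B).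
Local Notation Sq := (square cocommH).
Local Notation d2 := (cc_ob Sq).
Local Notation Δ2 := (comul_of (cc_str Sq)).
Local Notation I := (wid [:: h]).
Local Notation J := (wid [:: d2]).
Local Notation K := (wid [:: b]).
Local Notation q1 := (q1 cocommH).
Local Notation q2 := (q2 cocommH).
Local Notation unpack2 := (unpack2 cocommH).
Local Notation pack2 := (pack2 cocommH).
Local Notation conv2 := (convolution (deltaHH H) m).

Lemma pair_unpack2 (s : [:: h; h] ~> [:: b]) : pair (D := Sq) s q1 q2 = s ∘ unpack2.
Proof. rewrite -unpack2E /pair; diagram. Qed.

(** The instance of [Act_twisted] at the two projections of the square. *)
Lemma twistedP s : twisted_condition φ s <->
  rmul (Act φ q1 (Act φ q2 (var B Sq))) (pair s q1 q2)
  = lmul (pair s q1 q2) (Act φ (qmul q1 q2) (var B Sq)).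
Proof.
have hq1 := q1_comult cocommH; have hq2 := q2_comult cocommH.
rewrite twisted_lhs // twisted_rhs //.
have -> : (q1 ⊗ q2 ⊗ var B Sq) ∘ (((Δ2 ⊗ J) ∘ Δ2) ⊗ K) = unpack2 ⊗ K.
  rewrite /var; redraw (((q1 ⊗ q2) ∘ Δ2 ∘ ((J ⊗ counit_of (cc_str Sq)) ∘ Δ2)) ⊗ K).
  rewrite comul1r -unpack2E; diagram.
split=> [->|e] //; rewrite /twisted_condition.
match goal with |- ?l = ?r =>
  redraw (l ∘ (wid [:: h; h] ⊗ K)); redraw back (r ∘ (wid [:: h; h] ⊗ K)) end.
rewrite -(pack2K cocommH).
match type of e with ?l = ?r =>
  redraw (l ∘ (pack2 ⊗ K)); redraw back (r ∘ (pack2 ⊗ K)) end.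
by rewrite e.
Qed.

Lemma twisted_mul s g : twisted_condition φ s ->
  commutes (D := Sq) (B := B) (g ∘ unpack2) -> twisted_condition φ (conv2 s g).
Proof.
move=> /twistedP e cg; apply/twistedP.
rewrite pair_cmul; [|exact: q1_comult|exact: q2_comult].
rewrite rmul_cmul e -lmul_rmul (pair_unpack2 g) -(commutes_lmul _ cg).
by rewrite -lmul_cmul.
Qed.

End TwistedProduct.

(** * Transport along the center *)

Section Center.
Variables (C : ssmcat) (H : weak_hopf C) (B Z : algebra C).
Variable z : [:: alg_ob Z] ~> [:: alg_ob B].
Hypotheses (z_mono : monomorphism z) (z_central : central z).
Hypothesis z_mor : algebra_morphism z.
Local Notation h := (wh_ob H).
Local Notation b := (alg_ob B).
Local Notation a := (alg_ob Z).
Variables (φ : [:: h; b] ~> [:: b]) (ψ : [:: h; a] ~> [:: a]).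
Hypothesis z_act : z ∘ ψ = φ ∘ (wid [:: h] ⊗ z).
Local Notation K := (wid [:: b]).
Local Notation m := (amul B).

Lemma center_inj w (f g : w ~> [:: a]) : z ∘ f = z ∘ g -> f = g.
Proof. exact: (z_mono (X := tensor_word w)). Qed.

Lemma commutes_center (D : cocomm_coalgebra C) (y : [:: cc_ob D] ~> [:: a]) :
  commutes (z ∘ y).
Proof.
rewrite /commutes.
redraw (m ∘ wsym [:: b] [:: b] ∘ (K ⊗ z) ∘ (K ⊗ y) ∘ wsym [:: cc_ob D] [:: b]).
rewrite -z_central; diagram.
Qed.

Lemma center_conv w (delta : w ~> w ++ w) f g :
  z ∘ convolution delta (amul Z) f g = convolution delta m (z ∘ f) (z ∘ g).
Proof.
rewrite /convolution; apply: Arr_inj.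
have e : acomp (Arr z) (Arr (amul Z)) = acomp (Arr m) (atens (Arr z) (Arr z)).
  by rewrite -compE z_mor.2; exact: compE.
have tf : Arr (f ⊗ g : w ++ w ~> [:: a; a]) = atens (Arr f) (Arr g) by [].
have tz : Arr ((z ∘ f) ⊗ (z ∘ g) : w ++ w ~> [:: b; b])
    = acomp (atens (Arr z) (Arr z)) (atens (Arr f) (Arr g)).
  by rewrite -tens_comp // -!compE.
by rewrite !compE tf tz !acompA ?cod_comp ?dom_comp // e.
Qed.

Lemma center_reg w (delta : w ~> w ++ w) uZ uB f g : z ∘ uZ = uB ->
  regular_inverse (B := Z) delta uZ f g <->
  regular_inverse (B := B) delta uB (z ∘ f) (z ∘ g).
Proof.
move=> <-; rewrite /regular_inverse -!center_conv.
split=> [[e1 e2 e3 e4]|[e1 e2 e3 e4]]; first by rewrite e1 e2 in e3 e4 *; rewrite e3 e4.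
by split; apply: center_inj.
Qed.

Lemma center_u1 : z ∘ u1 ψ = u1 φ.
Proof.
rewrite /u1; redraw ((z ∘ ψ) ∘ (wid [:: h] ⊗ aunit Z)); rewrite z_act.
redraw (φ ∘ (wid [:: h] ⊗ (z ∘ aunit Z))); by rewrite z_mor.1.
Qed.

Lemma center_u2 : z ∘ u2 ψ = u2 φ.
Proof. by rewrite /u2 -center_u1; diagram. Qed.

Lemma center_u3 : z ∘ u3 ψ = u3 φ.
Proof. by rewrite /u3 -center_u1; diagram. Qed.

Lemma center_coface0 t : z ∘ coface0 ψ t = coface0 φ (z ∘ t).
Proof.
rewrite /coface0; redraw ((z ∘ ψ) ∘ (wid [:: h] ⊗ t)); rewrite z_act; diagram.
Qed.

End Center.

(** * Cocycles and coboundaries in the group of regular morphisms *)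

Section Cancellation.
Variables (C : ssmcat) (B : algebra C) (D : cocomm_coalgebra C).
Local Notation mor := ([:: cc_ob D] ~> [:: alg_ob B]).
Local Notation "f ⋆ g" := (cmul f g) (at level 39, left associativity).
Local Notation reg := (regular_inverse (B := B) (comul_of (cc_str D))).

Lemma reg_mul w s t f g : reg w s t -> reg w f g -> reg w (s ⋆ f) (g ⋆ t).
Proof.
move=> st fg; have [/regP[st1 ts1 ws wt] /regP[fg1 gf1 wf wg]] := (st, fg).
apply/regP; rewrite !cmulA ws wg; split=> //.
  by rewrite -(cmulA s) fg1 (reg_unitr st).
by rewrite -(cmulA g) ts1 (reg_unitr (reg_sym fg)).
Qed.

Variables (w s0 s1 s2 s3 t0 t1 t2 t3 f0 f1 f2 f3 g0 g1 g2 g3 : mor).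
Hypotheses (r0 : reg w s0 t0) (r1 : reg w s1 t1) (r2 : reg w s2 t2) (r3 : reg w s3 t3).
Hypotheses (k0 : reg w f0 g0) (k1 : reg w f1 g1) (k2 : reg w f2 g2) (k3 : reg w f3 g3).
Hypotheses (cf0 : commutes f0) (cf1 : commutes f1).
Hypotheses (cf2 : commutes f2) (cf3 : commutes f3).
Hypotheses (cg0 : commutes g0) (cg1 : commutes g1).
Hypotheses (cg2 : commutes g2) (cg3 : commutes g3).

(** Here s_i and t_i are the i-th cofaces of σ and of its inverse, and f_i and g_i
    those of a central f and of its inverse.  Central factors are collected,
    and what is left of f_0 g_1 f_2 g_3 after cancelling f_0 and f_2 is
    g_3 g_1. *)
Lemma cocycle_of_coboundary :
  s0 ⋆ s2 ⋆ t1 ⋆ t3 = f0 ⋆ g1 ⋆ f2 ⋆ g3 ->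
  (s0 ⋆ g0) ⋆ (s2 ⋆ g2) = (s3 ⋆ g3) ⋆ (s1 ⋆ g1).
Proof.
set c := f0 ⋆ _ ⋆ _ ⋆ _ => e.
have cc : commutes c by do !apply: commutes_cmul2.
have [/regP[_ ts1 _ _] /regP[_ ts3 ws3 _]] := (r1, r3).
have e' : s0 ⋆ s2 = c ⋆ (s3 ⋆ s1).
  rewrite -e (cmulA _ s3) -(cmulA _ t3) ts3 -(cmulA _ t1 w) (reg_unitr (reg_sym r1)).
  by rewrite -(cmulA _ t1) ts1 -cmulA (reg_unitr r2).
have ec : c ⋆ g0 ⋆ g2 = g3 ⋆ g1.
  have [/regP[_ gf0 _ _] /regP[_ gf2 _ _]] := (k0, k2); have /regP[_ _ _ wg1] := k1.
  rewrite -(commutes_cmul c cg0) /c !cmulA gf0 wg1 -(cmulA g1) -(cmulA g1).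
  rewrite -(commutes_cmul _ cg2) (cmulA g2) gf2 cmulA (reg_unitr (reg_sym k1)).
  exact: commutes_cmul.
have -> : s0 ⋆ g0 ⋆ (s2 ⋆ g2) = s0 ⋆ s2 ⋆ g0 ⋆ g2.
  by rewrite cmulA -(cmulA s0) (commutes_cmul _ cg0) cmulA.
have -> : s3 ⋆ g3 ⋆ (s1 ⋆ g1) = s3 ⋆ s1 ⋆ (g3 ⋆ g1).
  by rewrite cmulA -(cmulA s3) (commutes_cmul _ cg3) !cmulA.
by rewrite e' (commutes_cmul _ cc) -ec !cmulA.
Qed.

Lemma coboundary_of_cocycle :
  (s0 ⋆ f0) ⋆ (s2 ⋆ f2) = (s3 ⋆ f3) ⋆ (s1 ⋆ f1) ->
  s0 ⋆ s2 ⋆ t1 ⋆ t3 = g0 ⋆ f1 ⋆ g2 ⋆ f3.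
Proof.
have [/regP[st1 _ _ _] /regP[st3 _ _ _]] := (r1, r3).
have [/regP[fg0 _ _ _] /regP[fg2 _ _ _]] := (k0, k2).
rewrite !cmulA -(cmulA s0) (commutes_cmul _ cf0) cmulA.
rewrite -(cmulA s3) (commutes_cmul _ cf3) cmulA -(cmulA _ f3) => e.
set c := g0 ⋆ _ ⋆ _ ⋆ _.
have cc : commutes c by do !apply: commutes_cmul2.
have ec : f3 ⋆ f1 ⋆ g2 ⋆ g0 = c.
  by rewrite -(commutes_cmul _ cg0) /c -!cmulA (commutes_cmul _ cf3) -!cmulA.
have e' : s0 ⋆ s2 = s3 ⋆ s1 ⋆ c.
  have := congr1 (fun x => x ⋆ g2 ⋆ g0) e => /=.
  rewrite -(cmulA _ f2) fg2 -(cmulA _ f0 w) (reg_unitr k0) -(cmulA _ f0) fg0.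
  rewrite -(cmulA s0) (reg_unitr r2) => ->.
  by rewrite -ec !cmulA.
rewrite e' -(commutes_cmul _ cc) -(cmulA c) -(cmulA c).
rewrite -(cmulA s3 s1) st1 (reg_unitr r3) st3 /c.
by rewrite -cmulA (reg_unitr k3).
Qed.

End Cancellation.

(** * The obstruction *)

Section Products.
Variables (C : ssmcat) (H : weak_hopf C) (B : algebra C).
Hypothesis cocommH : cocommutative H.
Variable φ : [:: wh_ob H; alg_ob B] ~> [:: alg_ob B].
Hypothesis weakB : weak_module_algebra φ.
Local Notation h := (wh_ob H).
Local Notation b := (alg_ob B).
Local Notation m := (amul B).
Local Notation Sq := (square cocommH).
Local Notation Cu := (cube cocommH).
Local Notation unpack2 := (unpack2 cocommH).
Local Notation unpack3 := (unpack3 cocommH).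
Local Notation conv2 := (convolution (deltaHH H) m).
Local Notation reg2 := (regular_inverse (B := B) (deltaHH H) (u2 φ)).
Local Notation "f ⋆ g" := (cmul f g) (at level 39, left associativity).
Implicit Types s t f g : [:: h; h] ~> [:: b].
Let hp1 := p1_comult cocommH.
Let hp2 := p2_comult cocommH.
Let hp3 := p3_comult cocommH.

Lemma coface0_conv s f : coface0 φ (conv2 s f) ∘ unpack3
  = (coface0 φ s ∘ unpack3) ⋆ (coface0 φ f ∘ unpack3).
Proof. by rewrite !coface0E pair_cmul // act_cmul. Qed.

Lemma coface1_conv s f : coface1 (B := B) (conv2 s f) ∘ unpack3
  = (coface1 (B := B) s ∘ unpack3) ⋆ (coface1 (B := B) f ∘ unpack3).
Proof. by rewrite !coface1E pair_cmul //; apply: qmul_comult. Qed.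

Lemma coface2_conv s f : coface2 (B := B) (conv2 s f) ∘ unpack3
  = (coface2 (B := B) s ∘ unpack3) ⋆ (coface2 (B := B) f ∘ unpack3).
Proof. by rewrite !coface2E pair_cmul //; apply: qmul_comult. Qed.

Lemma coface3_conv s f : coface3 (B := B) (conv2 s f) ∘ unpack3
  = (coface3 (B := B) s ∘ unpack3) ⋆ (coface3 (B := B) f ∘ unpack3).
Proof.
by rewrite !coface3E pair_cmul //; apply: qmul_comult => //; apply: PiL_comult.
Qed.

Lemma conv2E s f : conv2 s f ∘ unpack2
  = cmul (B := B) (D := Sq) (s ∘ unpack2) (f ∘ unpack2).
Proof.
rewrite -!pair_unpack2 pair_cmul //; [exact: q1_comult | exact: q2_comult].
Qed.

Lemma reg_unpack2 f g : reg2 f g <-> regular_inverse (B := B) (comul_of (cc_str Sq))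
  (u2 φ ∘ unpack2) (f ∘ unpack2) (g ∘ unpack2).
Proof.
rewrite /regular_inverse -!/(cmul _ _) -!conv2E.
by split=> [[-> -> -> ->]|[e1 e2 e3 e4]] //; split; apply: unpack2_inj; eauto.
Qed.

Lemma conv2_reg s t f g : reg2 s t -> reg2 f g -> reg2 (conv2 s f) (conv2 g t).
Proof.
move=> /reg_unpack2 st /reg_unpack2 fg; apply/reg_unpack2; rewrite !conv2E.
exact: reg_mul.
Qed.

(** Applied to α = σ ∗ (σ^{-1} ∗ α) below. *)
Lemma conv2_cancel s t f g : reg2 s t -> reg2 f g -> conv2 s (conv2 t f) = f.
Proof.
move=> /reg_unpack2/regP[st _ _ _] /reg_unpack2/regP[_ _ uf _].
by apply: unpack2_inj; rewrite !conv2E cmulA st.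
Qed.

Lemma quotient_conv2_commutes s t f g : reg2 s t -> reg2 f g ->
  twisted_condition φ s -> twisted_condition φ f ->
  commutes (B := B) (D := Sq) (conv2 t f ∘ unpack2).
Proof.
move=> st fg tw tw'; rewrite conv2E -!pair_unpack2.
apply: (quotient_commutes cocommH weakB st fg tw tw').
  exact: q1_comult.
exact: q2_comult.
Qed.

Lemma pre_obstructionE s t : reg2 s t -> pre_obstruction φ s ∘ unpack3
  = (coface0 φ s ∘ unpack3) ⋆ (coface2 (B := B) s ∘ unpack3)
    ⋆ (coface1 (B := B) t ∘ unpack3) ⋆ (coface3 (B := B) t ∘ unpack3).
Proof.
move=> st; rewrite /pre_obstruction (inv_coface1 cocommH st).
by rewrite (inv_coface3 cocommH weakB st) !conv3E.
Qed.

Variables (Z : algebra C) (z : [:: alg_ob Z] ~> [:: b]).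
Hypothesis centerB : is_center z.
Variable ψ : [:: h; alg_ob Z] ~> [:: alg_ob Z].
Hypothesis z_act : z ∘ ψ = φ ∘ (wid [:: h] ⊗ z).
Local Notation reg2Z := (regular_inverse (B := Z) (deltaHH H) (u2 ψ)).

Implicit Types x y : [:: h; h] ~> [:: alg_ob Z].

Lemma center_reg2 x y : reg2Z x y <-> reg2 (z ∘ x) (z ∘ y).
Proof.
case: centerB => z_mono _ _ z_mor.
apply: (center_reg z_mono z_mor _ _ _ (center_u2 z_mor z_act)).
Qed.

(** The universal property of the center is about single objects, hence the
    detour through [unpack2]. *)
Lemma center_factor f : commutes (B := B) (D := Sq) (f ∘ unpack2) ->
  exists x, z ∘ x = f.
Proof.
case: centerB => _ _ univ _ cf.
have cent : central (f ∘ unpack2 : [:: cc_ob Sq] ~> [:: b]).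
  rewrite /central; redraw (m ∘ wsym [:: b] [:: b]
    ∘ ((f ∘ unpack2) ⊗ wid [:: b]) ∘ wsym [:: b] [:: cc_ob Sq]).
  rewrite -cf; diagram.
have [y [ey _]] := univ _ _ cent.
exists (y ∘ pack2 cocommH); redraw ((z ∘ y) ∘ pack2 cocommH); rewrite ey.
redraw (f ∘ (unpack2 ∘ pack2 cocommH)); rewrite pack2K; diagram.
Qed.

Lemma center_commutes y (w : [:: h; h; h] ~> [:: h; h]) :
  commutes (B := B) (D := Cu) ((z ∘ y ∘ w) ∘ unpack3).
Proof.
case: centerB => _ z_cent _ _.
have -> : (z ∘ y ∘ w) ∘ unpack3 = z ∘ (y ∘ w ∘ unpack3) by diagram.
exact: commutes_center.
Qed.

Lemma coface0_commutes x : commutes (B := B) (D := Cu) (coface0 φ (z ∘ x) ∘ unpack3).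
Proof.
case: centerB => _ z_cent _ _; rewrite -(center_coface0 z_act).
have -> : (z ∘ coface0 ψ x) ∘ unpack3 = z ∘ (coface0 ψ x ∘ unpack3) by diagram.
exact: commutes_center.
Qed.

(** The inclusion of the center reflects equations, so the inverses in the
    definition of [D2] exist for the center because they exist for B. *)
Lemma D2E x y : reg2Z x y -> (z ∘ D2 ψ x) ∘ unpack3
  = (coface0 φ (z ∘ x) ∘ unpack3) ⋆ (coface1 (B := B) (z ∘ y) ∘ unpack3)
    ⋆ (coface2 (B := B) (z ∘ x) ∘ unpack3) ⋆ (coface3 (B := B) (z ∘ y) ∘ unpack3).
Proof.
move=> xy; have fg := proj1 (center_reg2 _ _) xy.
case: centerB => z_mono _ _ z_mor.
have inv_coface (w : [:: h; h; h] ~> [:: h; h]) :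
    regular_inverse (B := B) (comul_of (cc_str Cu)) (u3 φ ∘ unpack3)
      (((z ∘ x) ∘ w) ∘ unpack3) (((z ∘ y) ∘ w) ∘ unpack3) ->
    inv3 ψ (x ∘ w) = y ∘ w.
  rewrite u3E => r; apply: (inv3E cocommH).
  apply/(center_reg z_mono z_mor _ _ _ (center_u3 z_mor z_act)).
  apply/(reg_unpack3 cocommH).
  have e v : z ∘ (v ∘ w) ∘ unpack3 = z ∘ v ∘ w ∘ unpack3 by diagram.
  by rewrite !e.
rewrite /D2 inv_coface; last by rewrite u3E; apply: coface1_reg fg.
rewrite inv_coface; last by rewrite u3E; apply: (coface3_reg cocommH weakB fg).
rewrite /conv3 !(center_conv z_mor) (center_coface0 z_act) -!/(conv3 _ _) !conv3E.
have e (v : [:: h; h] ~> [:: alg_ob Z]) w :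
  z ∘ (v ∘ w) ∘ unpack3 = z ∘ v ∘ w ∘ unpack3 by diagram.
by rewrite !e.
Qed.

End Products.

Theorem theorem5p12 (C : ssmcat) (split_idempotents : idempotents_split C)
    (H : weak_hopf C) (cocommH : cocommutative H)
    (B : algebra C) (phiB : [:: wh_ob H; alg_ob B] ~> [:: alg_ob B])
    (weakB : weak_module_algebra phiB)
    (Z : algebra C) (zB : [:: alg_ob Z] ~> [:: alg_ob B])
    (centerB : is_center zB)
    (sigma : [:: wh_ob H; wh_ob H] ~> [:: alg_ob B])
    (reg_sigma : Reg2 phiB sigma) (twisted_sigma : twisted_condition phiB sigma)
    (phiZ : [:: wh_ob H; alg_ob Z] ~> [:: alg_ob Z])
    (phiZ_def : zB ∘ phiZ = phiB ∘ (wid [:: wh_ob H] ⊗ zB))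
    (theta : [:: wh_ob H; wh_ob H; wh_ob H] ~> [:: alg_ob Z])
    (theta_def : zB ∘ theta = pre_obstruction phiB sigma) :
  in_Im_D2 phiZ theta <->
  (exists alpha : [:: wh_ob H; wh_ob H] ~> [:: alg_ob B],
     [/\ Reg2 phiB alpha, twisted_condition phiB alpha
       & cocycle_condition phiB alpha]).
Proof.
have [sigma' ss'] := reg_sigma.
have [z_mono z_cent _ _] := centerB.
pose conv2 := convolution (deltaHH H) (amul B).
have regs s t (st : regular_inverse (B := B) (deltaHH H) (u2 phiB) s t) :=
  (coface0_reg cocommH weakB st, coface1_reg cocommH st,
   coface2_reg cocommH st, coface3_reg cocommH weakB st).
have coms x := (coface0_commutes cocommH centerB phiZ_def x,
  center_commutes cocommH centerB x).
split=> [[tau [[tau' tt'] D2tau]]|[alpha [[alpha' aa'] tw_alpha cocycle_alpha]]].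
  have ff' := proj1 (center_reg2 centerB phiZ_def _ _) tt'.
  (* As D2 tau is the obstruction, the inverse of zB ∘ tau cancels it. *)
  exists (conv2 sigma (zB ∘ tau')); split.
  - exists (conv2 (zB ∘ tau) sigma'); apply: (conv2_reg cocommH ss').
    exact: (reg_sym ff').
  - apply: (twisted_mul (cocommH := cocommH)) => //.
    have -> : (zB ∘ tau') ∘ unpack2 cocommH = zB ∘ (tau' ∘ unpack2 cocommH) by diagram.
    exact: commutes_center.
  apply/(cocycleP cocommH weakB (conv2_reg cocommH ss' (reg_sym ff'))).
  rewrite coface0_conv // coface1_conv coface2_conv coface3_conv.
  apply: (cocycle_of_coboundary (regs _ _ ss').1.1.2
    (regs _ _ ss').1.2 (regs _ _ ss').2 (regs _ _ ff').1.1.1 (regs _ _ ff').1.1.2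
    (regs _ _ ff').1.2); try exact: (coms _).1; try exact: (coms _).2.
  by rewrite -(pre_obstructionE cocommH weakB ss') -theta_def -D2tau
    (D2E cocommH weakB centerB phiZ_def tt').
have comf : commutes (D := square cocommH) (conv2 sigma' alpha ∘ unpack2 cocommH).
  exact: (quotient_conv2_commutes cocommH weakB ss' aa').
have comg : commutes (D := square cocommH) (conv2 alpha' sigma ∘ unpack2 cocommH).
  exact: (quotient_conv2_commutes cocommH weakB aa' ss').
have [x ex] := center_factor centerB comf.
have [y ey] := center_factor centerB comg.
have ff' : regular_inverse (deltaHH H) (u2 phiB) (zB ∘ x) (zB ∘ y).
  by rewrite ex ey; apply: (conv2_reg cocommH (reg_sym ss') aa').
have xy := proj2 (center_reg2 centerB phiZ_def _ _) ff'.
(* y, not x: the coboundary of the quotient x of alpha by sigma is the inverse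
   of the obstruction. *)
exists y; split; first by exists x; apply: reg_sym.
apply: (center_inj z_mono); apply: (unpack3_inj (cocommH := cocommH)).
rewrite theta_def (pre_obstructionE cocommH weakB ss').
rewrite (D2E cocommH weakB centerB phiZ_def (reg_sym xy)).
apply: esym; apply: (coboundary_of_cocycle (regs _ _ ss').1.1.2
    (regs _ _ ss').1.2 (regs _ _ ss').2 (regs _ _ ff').1.1.1
    (regs _ _ ff').1.2 (regs _ _ ff').2); try exact: (coms _).1; try exact: (coms _).2.
have := proj1 (cocycleP cocommH weakB aa') cocycle_alpha.
have <- : conv2 sigma (zB ∘ x) = alpha.
  by rewrite ex; apply: (conv2_cancel cocommH ss' aa').
by rewrite coface0_conv // coface1_conv coface2_conv coface3_conv.
Qed.
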